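(* Let $\mathbb{F}$ be a field, $0\ne q\in\mathbb{F}$ not a root of unity, $n\ge1$, $r\ge 0$. Let $\pi$ and $\pi'$ be walks of length $r$ on the Bratteli diagram, and let $\mathfrak{c}_\pi,\mathfrak{c}_{\pi'}\in V_q^{\otimes r}$ be the associated vectors, where $V_q$ is the vector representation of $U_q(\mathfrak{gl}_n)$ (see the context). Let $\langle-,-\rangle$ be the symmetric bilinear form on $V_q^{\otimes r}$ for which the basis $\{v_{i_1}\otimes\cdots\otimes v_{i_r}\}$ is orthonormal. Then: (a) $\langle\mathfrak{c}_\pi,\mathfrak{c}_{\pi'}\rangle=0$ whenever $\pi\neq\pi'$. (b) $\langle\mathfrak{c}_\pi,\mathfrak{c}_\pi\rangle\neq0$.
   Context: Notation: $[m]=(q^m-q^{-m})/(q-q^{-1})$ for $m\in\mathbb{Z}$. **Algebra.** $U_q(\mathfrak{gl}_n)$ is the $\mathbb{F}$-algebra with generators $E_i,F_i$ ($1\le i\le n-1$), $K_i^{\pm1}$ ($1\le i\le n$) and relations: $K_iK_j=K_jK_i$, $K_iK_i^{-1}=1=K_i^{-1}K_i$; $E_iF_j-F_jE_i=\delta_{ij}\frac{\tilde K_i-\tilde K_i^{-1}}{q-q^{-1}}$ with $\tilde K_i=K_iK_{i+1}^{-1}$; $K_iE_j=q^{\delta_{i,j}-\delta_{i,j+1}}E_jK_i$, $K_iF_j=q^{-(\delta_{i,j}-\delta_{i,j+1})}F_jK_i$; $E_i^2E_j-(q+q^{-1})E_iE_jE_i+E_jE_i^2=0$ if $|i-j|=1$,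 $E_iE_j=E_jE_i$ if $|i-j|>1$; and the same two relations with every $E$ replaced by $F$. Tensor products are formed with the coproduct $\Delta(E_i)=E_i\otimes1+\tilde K_i\otimes E_i$, $\Delta(F_i)=F_i\otimes\tilde K_i^{-1}+1\otimes F_i$, $\Delta(K_i)=K_i\otimes K_i$. A vector $v$ has weight $\mu\in\mathbb{Z}^n$ if $K_iv=q^{\mu_i}v$ for all $i$. The vector representation $V_q$ has basis $v_1,\dots,v_n$ with $K_jv_i=q^{\delta_{ij}}v_i$, $F_iv_i=v_{i+1}$, $E_iv_{i+1}=v_i$, and $F_i$, $E_i$ kill all other basis vectors. A maximal vector of weight $\lambda$ is a nonzero vector of weight $\lambda$ killed by all $E_i$. **The elements $\Psi_j$.** Fix a partition $\lambda$, extended by zeros, and put $\alpha_i^\vee(\lambda)=\lambda_i-\lambda_{i+1}$. Set $c_1=0$, $c_m=\lambda_2-\lambda_{m+1}+m-1$ ($m\ge2$), $d_m=\lambda_1-\lambda_{m+1}+m-1$ ($m\ge1$). Define $\Psi_0=1$, $\Psi_1=F_1/[d_1]$ and $\Psi_m=\frac1{[d_m]}\big([c_m]F_1\Psi_{m-1}^+-[c_m-1]\Psi_{m-1}^+F_1\big)$ for $m\ge2$. Here the superscript $+$ replaces each $F_i$ by $F_{i+1}$ and each $\alpha_i$ by $\alpha_{i+1}$ (i.e. each $\lambda_i$ by $\lambda_{i+1}$), and $+(k)$ means shifting $k$ times. **The operators $\Phi_m$.** If $b$ is a maximal vector of weight $\lambda$ in a $U_q(\mathfrak{gl}_n)$-module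 $M$, then $\Phi_1(b)=v_1\otimes b$ and, for $2\le m\le n$ with $\alpha_{m-1}^\vee(\lambda)\ne0$, $\Phi_m(b)=\sum_{j=0}^{m-1}(-q^{-1})^j\,v_{m-j}\otimes\Psi_j^{+(m-j-1)}b\in V_q\otimes M$. The $\Psi$'s are formed with respect to the weight $\lambda$ of $b$. In this case $\Phi_m(b)$ is again a maximal vector, of weight $\lambda+\varepsilon_m$. **Walks.** The Bratteli diagram has as vertices at level $r$ the partitions of $r$ with at most $n$ parts, with an edge between vertices in successive levels that differ by one box. A walk of length $r$ is a sequence $\pi=(\emptyset=\pi^{(0)}\to\pi^{(1)}\to\cdots\to\pi^{(r)})$ in which each $\pi^{(j)}$ is obtained from $\pi^{(j-1)}$ by adding one box. If that box lies in row $k$ put $\Upsilon_j=\Phi_k$. Then $\mathfrak{c}_\pi=\Upsilon_r\Upsilon_{r-1}\cdots\Upsilon_1(1)\in V_q^{\otimes r}$, where $1$ spans $V_q^{\otimes0}=\mathbb{F}$. *)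

(* Defs.v *)
From HB Require Import structures.
From mathcomp Require Import all_boot all_order all_algebra.
From mathcomp Require Import ring zify.

Set Implicit Arguments.
Unset Strict Implicit.
Unset Printing Implicit Defensive.

Import Order.TTheory GRing.Theory Num.Theory.
Local Open Scope ring_scope.

(* Generators E_i, F_i, K_i, the basis v_i and the parts lambda_i are indexed by
   natural numbers starting from 1.  Indices out of range carry junk values that
   are never used. *)

Definition qint (F : fieldType) (q : F) (m : int) : F :=
  (q ^ m - q ^ (- m)) / (q - q^-1).

(* The operators by which E_i, F_i, K_i and K_i^-1 act on M. *)
Record uq_ops (M : Type) := UqOps {
  opE : nat -> M -> M;
  opF : nat -> M -> M;
  opK : nat -> M -> M;
  opKV : nat -> M -> M
}.

Definition opKt (M : Type) (A : uq_ops M) (i : nat) (x : M) : M :=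
  opK A i (opKV A i.+1 x).

Definition opKtV (M : Type) (A : uq_ops M) (i : nat) (x : M) : M :=
  opKV A i (opK A i.+1 x).

Definition serre (F : fieldType) (M : lmodType F) (q : F) (n : nat)
    (e : nat -> M -> M) : Prop :=
  (forall i j x, (0 < i < n)%N -> (0 < j < n)%N -> (i == j.+1) || (j == i.+1) ->
     e i (e i (e j x)) - (q + q^-1) *: e i (e j (e i x)) + e j (e i (e i x)) = 0)
  /\
  (forall i j x, (0 < i < n)%N -> (0 < j < n)%N -> (i.+1 < j)%N || (j.+1 < i)%N ->
     e i (e j x) = e j (e i x)).

(* A module over the presented algebra U_q(gl_n): linear operators satisfying the
   defining relations. *)
Record is_uq_module (F : fieldType) (M : lmodType F) (q : F) (n : nat)
    (A : uq_ops M) : Prop := IsUqModule {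
  uq_linE : forall i, linear (opE A i);
  uq_linF : forall i, linear (opF A i);
  uq_linK : forall i, linear (opK A i);
  uq_linKV : forall i, linear (opKV A i);
  uq_KK : forall i j x, (0 < i <= n)%N -> (0 < j <= n)%N ->
    opK A i (opK A j x) = opK A j (opK A i x);
  uq_KKV : forall i x, (0 < i <= n)%N -> opK A i (opKV A i x) = x;
  uq_KVK : forall i x, (0 < i <= n)%N -> opKV A i (opK A i x) = x;
  uq_EF : forall i j x, (0 < i < n)%N -> (0 < j < n)%N ->
    opE A i (opF A j x) - opF A j (opE A i x) =
    if i == j then (q - q^-1)^-1 *: (opKt A i x - opKtV A i x) else 0;
  uq_KE : forall i j x, (0 < i <= n)%N -> (0 < j < n)%N ->
    opK A i (opE A j x) =
    q ^ ((i == j)%:Z - (i == j.+1)%:Z) *: opE A j (opK A i x);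
  uq_KF : forall i j x, (0 < i <= n)%N -> (0 < j < n)%N ->
    opK A i (opF A j x) =
    q ^ (- ((i == j)%:Z - (i == j.+1)%:Z)) *: opF A j (opK A i x);
  uq_serreE : serre q n (opE A);
  uq_serreF : serre q n (opF A)
}.

(* For V = F^I, the space V (x) M is modelled by I -> M, and u (x) b by
   k |-> u_k b. *)
Definition tens (F : fieldType) (I : finType) (M : lmodType F)
    (u : {ffun I -> F^o}) (b : M) : {ffun I -> M} := [ffun k => u k *: b].

Definition basis_vec (F : fieldType) (I : finType) (k : I) : {ffun I -> F^o} :=
  [ffun l => (l == k)%:R].

(* The operator f (x) g; see tens_op_tens. *)
Definition tens_op (F : fieldType) (I : finType) (M : lmodType F)
    (f : {ffun I -> F^o} -> {ffun I -> F^o}) (g : M -> M)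
    (x : {ffun I -> M}) : {ffun I -> M} :=
  \sum_(k : I) tens (f (basis_vec F k)) (g (x k)).

(* V (x) M, with U_q(gl_n) acting through the coproduct. *)
Definition tens_uq (F : fieldType) (I : finType) (M : lmodType F)
    (A : uq_ops {ffun I -> F^o}) (B : uq_ops M) : uq_ops {ffun I -> M} :=
  {| opE i x := tens_op (opE A i) id x + tens_op (opKt A i) (opE B i) x;
     opF i x := tens_op (opF A i) (opKtV B i) x + tens_op id (opF B i) x;
     opK i x := tens_op (opK A i) (opK B i) x;
     opKV i x := tens_op (opKV A i) (opKV B i) x |}.

(* The trivial module, given by the counit. *)
Definition triv_uq (F : fieldType) : uq_ops F^o :=
  {| opE i x := 0; opF i x := 0; opK i x := x; opKV i x := x |}.

Definition vb (F : fieldType) (n i : nat) : {ffun 'I_n -> F^o} :=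
  [ffun k : 'I_n => (k.+1 == i)%:R].

(* The linear map with v_i |-> f i for 1 <= i <= n. *)
Definition lin_ext (F : fieldType) (n : nat) (f : nat -> {ffun 'I_n -> F^o})
    (x : {ffun 'I_n -> F^o}) : {ffun 'I_n -> F^o} :=
  \sum_(k < n) x k *: f k.+1.

Definition vec_uq (F : fieldType) (q : F) (n : nat) : uq_ops {ffun 'I_n -> F^o} :=
  {| opE i := lin_ext (fun k => if k == i.+1 then vb F n i else 0);
     opF i := lin_ext (fun k => if k == i then vb F n i.+1 else 0);
     opK j := lin_ext (fun k => q ^ (k == j)%:Z *: vb F n k);
     opKV j := lin_ext (fun k => q ^ (- (k == j)%:Z) *: vb F n k) |}.

Fixpoint tpow (F : fieldType) (n r : nat) : lmodType F :=
  if r is r'.+1 then {ffun 'I_n -> tpow F n r'} else F^o.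

Fixpoint tpow_uq (F : fieldType) (q : F) (n r : nat) : uq_ops (tpow F n r) :=
  match r with
  | 0 => triv_uq F
  | r'.+1 => tens_uq (vec_uq q n) (tpow_uq q n r')
  end.

Fixpoint tpow_basis (F : fieldType) (n r : nat) :
    r.-tuple 'I_n -> tpow F n r :=
  match r with
  | 0 => fun _ => (1 : F^o)
  | r'.+1 => fun t : r'.+1.-tuple 'I_n =>
      tens (vb F n (thead t).+1) (tpow_basis F (behead_tuple t))
  end.

(* The bilinear form making tpow_basis orthonormal; see tform_basis. *)
Fixpoint tform (F : fieldType) (n r : nat) :
    tpow F n r -> tpow F n r -> F :=
  match r with
  | 0 => fun x y : F^o => x * y
  | r'.+1 => fun x y : {ffun 'I_n -> tpow F n r'} =>
      \sum_(k < n) tform (x k) (y k)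
  end.

Definition part (lam : seq nat) (i : nat) : int := (nth 0%N lam i.-1)%:Z.

(* The superscript +(k), on the families (F_i) and (lambda_i). *)
Definition shift (T : Type) (k : nat) (f : nat -> T) (i : nat) : T := f (i + k)%N.

Definition cc (lam : nat -> int) (m : nat) : int :=
  if (m <= 1)%N then 0 else lam 2%N - lam m.+1 + m%:Z - 1.

Definition dd (lam : nat -> int) (m : nat) : int :=
  lam 1%N - lam m.+1 + m%:Z - 1.

(* The action of Psi_m on a module on which F_i acts as f i. *)
Fixpoint Psi (F : fieldType) (q : F) (M : lmodType F) (f : nat -> M -> M)
    (lam : nat -> int) (m : nat) (x : M) : M :=
  match m with
  | 0 => x
  | 1 => (qint q (dd lam 1))^-1 *: f 1%N x
  | m'.+1 =>
      let Psi' := Psi q (shift 1 f) (shift 1 lam) m' in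
      (qint q (dd lam m))^-1 *:
        (qint q (cc lam m) *: f 1%N (Psi' x)
         - qint q (cc lam m - 1) *: Psi' (f 1%N x))
  end.

(* For m = 1 the sum is v_1 (x) b. *)
Definition Phi (F : fieldType) (q : F) (n : nat) (M : lmodType F) (A : uq_ops M)
    (lam : seq nat) (m : nat) (b : M) : {ffun 'I_n -> M} :=
  \sum_(j < m) (- q^-1) ^+ j *:
     tens (vb F n (m - j))
          (Psi q (shift (m - j - 1) (opF A)) (shift (m - j - 1) (part lam)) j b).

Definition is_partition (lam : seq nat) : bool :=
  sorted geq lam && (0%N \notin lam).

Definition bratteli_vertex (n r : nat) (lam : seq nat) : bool :=
  [&& is_partition lam, (size lam <= n)%N & sumn lam == r].

Definition bratteli_edge (n : nat) (lam mu : seq nat) : bool :=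
  [exists k : 'I_n, mu == incr_nth lam k].

Definition is_walk (n r : nat) (s : seq (seq nat)) : bool :=
  [forall j : 'I_r.+1, bratteli_vertex n j (nth [::] s j)] &&
  [forall j : 'I_r, bratteli_edge n (nth [::] s j) (nth [::] s j.+1)].

Record walk (n r : nat) := Walk {
  walk_seq :> r.+1.-tuple (seq nat);
  walkP : is_walk n r walk_seq
}.

HB.instance Definition _ (n r : nat) := [isSub for @walk_seq n r].
HB.instance Definition _ (n r : nat) := [Equality of walk n r by <:].

(* The row, counted from 1, of the box added along an edge lam -> mu. *)
Definition box_row (n : nat) (lam mu : seq nat) : nat :=
  (find (fun k => mu == incr_nth lam k) (iota 0 n)).+1.

(* The vector attached to the walk pi 0 -> ... -> pi r. *)
Fixpoint cvec_of (F : fieldType) (q : F) (n : nat) (pi : nat -> seq nat)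
    (r : nat) : tpow F n r :=
  match r with
  | 0 => (1 : F^o)
  | r'.+1 => Phi q n (tpow_uq q n r') (pi r') (box_row n (pi r') (pi r'.+1))
               (cvec_of q n pi r')
  end.

Definition cvec (F : fieldType) (q : F) (n r : nat) (pi : walk n r) :
    tpow F n r :=
  cvec_of q n (fun j => nth [::] pi j) r.

Section LinearFacts.
Variables (F : fieldType) (U W : lmodType F).

Lemma lin_D (f : U -> W) : linear f -> {morph f : x y / x + y}.
Proof. by move=> lf x y; rewrite -[x]scale1r lf !scale1r. Qed.

Lemma lin_0 (f : U -> W) : linear f -> f 0 = 0.
Proof. by move=> lf; have := lf (-1) 0 0; rewrite scaler0 addr0 scaleN1r addNr. Qed.

Lemma lin_Z (f : U -> W) : linear f -> forall a x, f (a *: x) = a *: f x.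
Proof. by move=> lf a x; rewrite -[a *: x]addr0 lf (lin_0 lf) addr0. Qed.

Lemma lin_N (f : U -> W) : linear f -> forall x, f (- x) = - f x.
Proof. by move=> lf x; rewrite -!scaleN1r (lin_Z lf). Qed.

Lemma lin_B (f : U -> W) : linear f -> forall x y, f (x - y) = f x - f y.
Proof. by move=> lf x y; rewrite (lin_D lf) (lin_N lf). Qed.

Lemma lin_sum (f : U -> W) (J : Type) (s : seq J) (P : pred J) (g : J -> U) :
  linear f -> f (\sum_(j <- s | P j) g j) = \sum_(j <- s | P j) f (g j).
Proof. by move=> lf; apply: (big_morph f (lin_D lf) (lin_0 lf)). Qed.

Lemma lin_add (f g : U -> W) : linear f -> linear g -> linear (fun x => f x + g x).
Proof. by move=> lf lg a x y; rewrite lf lg scalerDr addrACA. Qed.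

Lemma lin_scale (c : F) (f : U -> W) : linear f -> linear (fun x => c *: f x).
Proof. by move=> lf a x y; rewrite lf scalerDr !scalerA mulrC. Qed.

Lemma lin_sub (f g : U -> W) : linear f -> linear g -> linear (fun x => f x - g x).
Proof.
by move=> lf lg a x y; rewrite lf lg scalerBr opprD addrACA.
Qed.

Lemma lin_cst0 : linear (fun _ : U => 0 : W).
Proof. by move=> a x y; rewrite scaler0 addr0. Qed.

End LinearFacts.

Lemma lin_id (F : fieldType) (U : lmodType F) : linear (@id U).
Proof. by []. Qed.

Lemma lin_comp (F : fieldType) (U V W : lmodType F) (g : V -> W) (f : U -> V) :
  linear g -> linear f -> linear (fun x => g (f x)).
Proof. by move=> lg lf a x y; rewrite lf lg. Qed.

(* Linear combinations, compared coefficientwise. *)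
Inductive lexp (F : Type) : Type :=
  | LVar of nat
  | LAdd of lexp F & lexp F
  | LScale of F & lexp F.

Fixpoint leval (F : fieldType) (M : lmodType F) (s : seq M) (e : lexp F) : M :=
  match e with
  | LVar i => nth 0 s i
  | LAdd a b => leval s a + leval s b
  | LScale c a => c *: leval s a
  end.

Fixpoint lcoef (F : fieldType) (e : lexp F) (i : nat) : F :=
  match e with
  | LVar j => if i == j then 1 else 0
  | LAdd a b => lcoef a i + lcoef b i
  | LScale c a => c * lcoef a i
  end.

Lemma levalE (F : fieldType) (M : lmodType F) (s : seq M) (e : lexp F) :
  leval s e = \sum_(i < size s) lcoef e i *: nth 0 s i.
Proof.
elim: e => [j|a IHa b IHb|c a IHa] /=; last first.
- by rewrite IHa scaler_sumr; apply: eq_bigr => i _; rewrite scalerA.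
- by rewrite IHa IHb -big_split; apply: eq_bigr => i _; rewrite scalerDl.
have [lt_j|le_j] := ltnP j (size s).
  rewrite (bigD1 (Ordinal lt_j)) //= eqxx scale1r big1 ?addr0 // => i.
  by rewrite -val_eqE /= => /negPf->; rewrite scale0r.
rewrite nth_default // big1 // => i _; case: eqP => [eq_ij|_].
  by have := ltn_ord i; rewrite eq_ij ltnNge le_j.
by rewrite scale0r.
Qed.

Lemma leval_eq0 (F : fieldType) (M : lmodType F) (s : seq M) (e : lexp F) :
  (forall i, (i < size s)%N -> lcoef e i = 0) -> leval s e = 0.
Proof. by move=> e0; rewrite levalE big1 // => i _; rewrite e0 ?scale0r. Qed.

Ltac lquote_var x s :=
  match s with
  | x :: _ => constr:(0%N)
  | _ :: ?s' => let k := lquote_var x s' in constr:(k.+1)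
  end.

Ltac lquote F s t :=
  match t with
  | ?a + ?b => let a' := lquote F s a in let b' := lquote F s b in
               constr:(LAdd a' b')
  | ?c *: ?a => let a' := lquote F s a in constr:(LScale (c : F) a')
  | ?x => let k := lquote_var x s in constr:(LVar F k)
  end.

Ltac lquote_goal F s :=
  match goal with |- ?t = 0 =>
    let e := lquote F s t in change (leval s e = 0); apply: leval_eq0
  end.

(* The Serre relation for X = P + Q and Y = P' + Q'. *)
Lemma serre_add (F : fieldType) (W : lmodType F) (t : F)
    (P Q P' Q' : W -> W) :
  t != 0 -> linear P -> linear Q -> linear P' -> linear Q' ->
  (forall x, Q (P x) = t ^+ 2 *: P (Q x)) ->
  (forall x, Q (P' x) = t^-1 *: P' (Q x)) ->
  (forall x, Q' (P x) = t^-1 *: P (Q' x)) ->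
  (forall x, P (P (P' x)) - (t + t^-1) *: P (P' (P x)) + P' (P (P x)) = 0) ->
  (forall x, Q (Q (Q' x)) - (t + t^-1) *: Q (Q' (Q x)) + Q' (Q (Q x)) = 0) ->
  let X x := P x + Q x in let Y x := P' x + Q' x in
  forall x, X (X (Y x)) - (t + t^-1) *: X (Y (X x)) + Y (X (X x)) = 0.
Proof.
move=> t0 lP lQ lP' lQ' QP QP' Q'P sP sQ X Y x; rewrite /X /Y.
have {}sP y : P (P (P' y)) = (t + t^-1) *: P (P' (P y)) - P' (P (P y)).
  by apply/eqP; rewrite -subr_eq0 opprB addrA addrAC sP.
have {}sQ y : Q (Q (Q' y)) = (t + t^-1) *: Q (Q' (Q y)) - Q' (Q (Q y)).
  by apply/eqP; rewrite -subr_eq0 opprB addrA addrAC sQ.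
rewrite !(lin_D lP, lin_D lQ, lin_D lP', lin_D lQ').
rewrite !(QP, QP', Q'P, lin_Z lP, lin_Z lQ, lin_Z lP', lin_Z lQ').
rewrite !(QP, QP', Q'P, lin_Z lP, lin_Z lQ, lin_Z lP', lin_Z lQ', sP, sQ).
rewrite -!scaleN1r.
lquote_goal F [:: P (P' (P x)); P' (P (P x)); P (P' (Q x)); P' (P (Q x));
  P (P (Q' x)); P (Q (Q' x)); P (Q' (Q x)); P' (Q (Q x));
  Q (Q' (Q x)); Q' (Q (Q x))].
by do 10?[case=> [_|]] => //=; field.
Qed.

Section ModuleFacts.
Variables (F : fieldType) (M : lmodType F) (q : F) (n : nat) (A : uq_ops M).
Hypotheses (q_neq0 : q != 0) (HA : is_uq_module q n A).

Let lE := uq_linE HA.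
Let lF := uq_linF HA.
Let lK := uq_linK HA.
Let lKV := uq_linKV HA.

Definition aij (i j : nat) : int :=
  ((i == j)%:Z - (i == j.+1)%:Z) - ((i.+1 == j)%:Z - (i.+1 == j.+1)%:Z).

Lemma opKt_lin i : linear (opKt A i).
Proof. exact: lin_comp (lK i) (lKV i.+1). Qed.

Lemma opKtV_lin i : linear (opKtV A i).
Proof. exact: lin_comp (lKV i) (lK i.+1). Qed.

Lemma exprz_cancel (c : int) (x y : M) : x = q ^ c *: y -> y = q ^ (- c) *: x.
Proof. by move=> ->; rewrite scalerA -expfzDr // addNr expr0z scale1r. Qed.

Lemma uq_KVE i j x : (0 < i <= n)%N -> (0 < j < n)%N ->
  opKV A i (opE A j x) =
  q ^ (- ((i == j)%:Z - (i == j.+1)%:Z)) *: opE A j (opKV A i x).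
Proof.
move=> hi hj; apply: exprz_cancel.
by rewrite -(lin_Z (lKV i)) -(uq_KVK HA (opE A j _) hi) (uq_KE HA) // (uq_KKV HA).
Qed.

Lemma uq_KVF i j x : (0 < i <= n)%N -> (0 < j < n)%N ->
  opKV A i (opF A j x) =
  q ^ ((i == j)%:Z - (i == j.+1)%:Z) *: opF A j (opKV A i x).
Proof.
move=> hi hj; rewrite -[X in q ^ X]opprK; apply: exprz_cancel.
by rewrite -(lin_Z (lKV i)) -(uq_KVK HA (opF A j _) hi) (uq_KF HA) // (uq_KKV HA).
Qed.

Lemma uq_KKVC i j x : (0 < i <= n)%N -> (0 < j <= n)%N ->
  opK A i (opKV A j x) = opKV A j (opK A i x).
Proof.
by move=> hi hj; rewrite -{2}(uq_KKV HA x hj) (uq_KK HA) // (uq_KVK HA).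
Qed.

Lemma uq_KVKV i j x : (0 < i <= n)%N -> (0 < j <= n)%N ->
  opKV A i (opKV A j x) = opKV A j (opKV A i x).
Proof.
move=> hi hj; rewrite -[RHS](uq_KVK HA _ hi) uq_KKVC // (uq_KKV HA) //.
Qed.

Lemma uq_KtE i j x : (0 < i < n)%N -> (0 < j < n)%N ->
  opKt A i (opE A j x) = q ^ aij i j *: opE A j (opKt A i x).
Proof.
move=> hi hj; have hi1 : (0 < i <= n)%N by lia.
rewrite /opKt uq_KVE //; last by lia.
rewrite (lin_Z (lK i)) (uq_KE HA) // scalerA -expfzDr // /aij.
by congr (q ^ _ *: _); ring.
Qed.

Lemma uq_KtF i j x : (0 < i < n)%N -> (0 < j < n)%N ->
  opKt A i (opF A j x) = q ^ (- aij i j) *: opF A j (opKt A i x).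
Proof.
move=> hi hj; have hi1 : (0 < i <= n)%N by lia.
rewrite /opKt uq_KVF //; last by lia.
rewrite (lin_Z (lK i)) (uq_KF HA) // scalerA -expfzDr // /aij.
by congr (q ^ _ *: _); ring.
Qed.

Lemma uq_KtVE i j x : (0 < i < n)%N -> (0 < j < n)%N ->
  opKtV A i (opE A j x) = q ^ (- aij i j) *: opE A j (opKtV A i x).
Proof.
move=> hi hj; have hi1 : (0 < i <= n)%N by lia.
rewrite /opKtV (uq_KE HA) //; last by lia.
rewrite (lin_Z (lKV i)) uq_KVE // scalerA -expfzDr // /aij.
by congr (q ^ _ *: _); ring.
Qed.

Lemma uq_KtVF i j x : (0 < i < n)%N -> (0 < j < n)%N ->
  opKtV A i (opF A j x) = q ^ aij i j *: opF A j (opKtV A i x).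
Proof.
move=> hi hj; have hi1 : (0 < i <= n)%N by lia.
rewrite /opKtV (uq_KF HA) //; last by lia.
rewrite (lin_Z (lKV i)) uq_KVF // scalerA -expfzDr // /aij.
by congr (q ^ _ *: _); ring.
Qed.

Lemma uq_EKtV i j x : (0 < i < n)%N -> (0 < j < n)%N ->
  opE A j (opKtV A i x) = q ^ aij i j *: opKtV A i (opE A j x).
Proof.
by move=> hi hj; rewrite -[X in q ^ X]opprK; apply: exprz_cancel; rewrite uq_KtVE.
Qed.

Lemma uq_FKtV i j x : (0 < i < n)%N -> (0 < j < n)%N ->
  opF A j (opKtV A i x) = q ^ (- aij i j) *: opKtV A i (opF A j x).
Proof. by move=> hi hj; apply: exprz_cancel; rewrite uq_KtVF. Qed.

Lemma uq_KtKt i j x : (0 < i < n)%N -> (0 < j < n)%N ->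
  opKt A i (opKt A j x) = opKt A j (opKt A i x).
Proof.
move=> hi hj; have [hi1 hi2] : (0 < i <= n)%N /\ (0 < i.+1 <= n)%N by split; lia.
have [hj1 hj2] : (0 < j <= n)%N /\ (0 < j.+1 <= n)%N by split; lia.
by rewrite /opKt -(uq_KKVC _ hj1) // (uq_KK HA) // uq_KVKV // -(uq_KKVC _ hi1).
Qed.

Lemma uq_KtVKtV i j x : (0 < i < n)%N -> (0 < j < n)%N ->
  opKtV A i (opKtV A j x) = opKtV A j (opKtV A i x).
Proof.
move=> hi hj; have [hi1 hi2] : (0 < i <= n)%N /\ (0 < i.+1 <= n)%N by split; lia.
have [hj1 hj2] : (0 < j <= n)%N /\ (0 < j.+1 <= n)%N by split; lia.
by rewrite /opKtV uq_KKVC // uq_KVKV // (uq_KK HA) // -(uq_KKVC _ hj2).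
Qed.

End ModuleFacts.

Section TensorFacts.
Variables (F : fieldType) (I : finType) (M : lmodType F).
Local Notation V := {ffun I -> F^o}.
Implicit Types (f : V -> V) (g : M -> M) (x : {ffun I -> M}).

Lemma tens_linl (b : M) : linear (fun u : V => tens u b).
Proof.
by move=> a u v; apply/ffunP => k; rewrite !ffunE scalerDl scalerA.
Qed.

Lemma tens_linr (u : V) : linear (@tens F I M u).
Proof.
by move=> a b c; apply/ffunP => k; rewrite !ffunE scalerDr !scalerA mulrC.
Qed.

Lemma basis_vecE (u : V) : u = \sum_k u k *: basis_vec F k.
Proof.
apply/ffunP => l; have sE (a b : F) : a *: (b : F^o) = a * b by [].
rewrite sum_ffunE (bigD1 l) //= !ffunE eqxx sE mulr1.
by rewrite big1 ?addr0 // => k /negPf nkl; rewrite !ffunE eq_sym nkl sE mulr0.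
Qed.

Lemma tens_basisE x : x = \sum_k tens (basis_vec F k) (x k).
Proof.
apply/ffunP => l; rewrite sum_ffunE (bigD1 l) //= !ffunE eqxx scale1r.
by rewrite big1 ?addr0 // => k /negPf nkl; rewrite !ffunE eq_sym nkl scale0r.
Qed.

Lemma tens_op_lin f g : linear g -> linear (tens_op f g).
Proof.
move=> lg a x y; rewrite /tens_op scaler_sumr -big_split; apply: eq_bigr => k _.
by rewrite /= !ffunE lg tens_linr.
Qed.

Lemma tens_op_tens f g (u : V) (b : M) :
  linear f -> linear g -> tens_op f g (tens u b) = tens (f u) (g b).
Proof.
move=> lf lg; rewrite [in RHS](basis_vecE u) (lin_sum _ _ _ lf).
rewrite (lin_sum _ _ _ (tens_linl (g b))); apply: eq_bigr => k _.
rewrite ffunE (lin_Z lg) (lin_Z lf).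
by rewrite (lin_Z (tens_linr _)) (lin_Z (tens_linl _)).
Qed.

Lemma tens_op_comp f g f' g' x : linear f -> linear g ->
  tens_op f g (tens_op f' g' x) = tens_op (f \o f') (g \o g') x.
Proof.
move=> lf lg; rewrite {2}/tens_op (lin_sum _ _ _ (tens_op_lin f lg)).
by apply: eq_bigr => k _; rewrite tens_op_tens.
Qed.

Lemma tens_op_comp3 f1 g1 f2 g2 f3 g3 x :
  linear f1 -> linear g1 -> linear f2 -> linear g2 ->
  tens_op f1 g1 (tens_op f2 g2 (tens_op f3 g3 x)) =
  tens_op (fun u => f1 (f2 (f3 u))) (fun b => g1 (g2 (g3 b))) x.
Proof. by move=> lf1 lg1 lf2 lg2; rewrite !tens_op_comp //; apply: lin_comp. Qed.

Lemma eq_tens_op f g f' g' x :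
  f =1 f' -> g =1 g' -> tens_op f g x = tens_op f' g' x.
Proof. by move=> ef eg; apply: eq_bigr => k _; rewrite ef eg. Qed.

Lemma tens_op_eqZl (c : F) f g f' g' x :
  (forall u, f u = c *: f' u) -> g =1 g' -> tens_op f g x = c *: tens_op f' g' x.
Proof.
move=> ef eg; rewrite /tens_op scaler_sumr; apply: eq_bigr => k _.
by rewrite ef eg (lin_Z (tens_linl _)).
Qed.

Lemma tens_op_eqZr (c : F) f g f' g' x :
  f =1 f' -> (forall b, g b = c *: g' b) -> tens_op f g x = c *: tens_op f' g' x.
Proof.
move=> ef eg; rewrite /tens_op scaler_sumr; apply: eq_bigr => k _.
by rewrite ef eg (lin_Z (tens_linr _)).
Qed.

Lemma tens_op_suml (c : F) f1 f2 f3 g x :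
  tens_op f1 g x - c *: tens_op f2 g x + tens_op f3 g x =
  tens_op (fun u => f1 u - c *: f2 u + f3 u) g x.
Proof.
rewrite /tens_op scaler_sumr -sumrB -big_split /=; apply: eq_bigr => k _.
by rewrite (lin_D (tens_linl _)) (lin_B (tens_linl _)) (lin_Z (tens_linl _)).
Qed.

Lemma tens_op_sumr (c : F) f g1 g2 g3 x :
  tens_op f g1 x - c *: tens_op f g2 x + tens_op f g3 x =
  tens_op f (fun b => g1 b - c *: g2 b + g3 b) x.
Proof.
rewrite /tens_op scaler_sumr -sumrB -big_split /=; apply: eq_bigr => k _.
by rewrite (lin_D (tens_linr _)) (lin_B (tens_linr _)) (lin_Z (tens_linr _)).
Qed.

Lemma tens_op_subl f1 f2 g x :
  tens_op f1 g x - tens_op f2 g x = tens_op (fun u => f1 u - f2 u) g x.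
Proof.
by rewrite /tens_op -sumrB; apply: eq_bigr => k _; rewrite (lin_B (tens_linl _)).
Qed.

Lemma tens_op_subr f g1 g2 x :
  tens_op f g1 x - tens_op f g2 x = tens_op f (fun b => g1 b - g2 b) x.
Proof.
by rewrite /tens_op -sumrB; apply: eq_bigr => k _; rewrite (lin_B (tens_linr _)).
Qed.

Lemma tens_op_0l f g x : (forall u, f u = 0) -> tens_op f g x = 0.
Proof.
by move=> f0; apply: big1 => k _; rewrite f0 (lin_0 (tens_linl _)).
Qed.

Lemma tens_op_0r f g x : (forall b, g b = 0) -> tens_op f g x = 0.
Proof.
by move=> g0; apply: big1 => k _; rewrite g0 (lin_0 (tens_linr _)).
Qed.

Lemma tens_op_id f g x : f =1 id -> g =1 id -> tens_op f g x = x.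
Proof.
by move=> f1 g1; rewrite [RHS]tens_basisE; apply: eq_bigr => k _; rewrite f1 g1.
Qed.

End TensorFacts.

Lemma tens_uqP (F : fieldType) (I : finType) (M : lmodType F) (q : F) (n : nat)
    (A : uq_ops {ffun I -> F^o}) (B : uq_ops M) :
  q != 0 -> is_uq_module q n A -> is_uq_module q n B ->
  is_uq_module q n (tens_uq A B).
Proof.
move=> q0 HA HB.
have lEA := uq_linE HA; have lFA := uq_linF HA; have lKA := uq_linK HA.
have lKVA := uq_linKV HA; have lEB := uq_linE HB; have lFB := uq_linF HB.
have lKB := uq_linK HB; have lKVB := uq_linKV HB.
have lKtA := opKt_lin HA; have lKtVA := opKtV_lin HA.
have lKtB := opKt_lin HB; have lKtVB := opKtV_lin HB.
have lidA := @lin_id F {ffun I -> F^o}; have lidB := @lin_id F M.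
split=> /=.
- by move=> i; apply: lin_add; apply: tens_op_lin.
- by move=> i; apply: lin_add; apply: tens_op_lin.
- by move=> i; apply: tens_op_lin.
- by move=> i; apply: tens_op_lin.
- move=> i j x hi hj; rewrite !tens_op_comp //.
  by apply: eq_tens_op => u /=; [rewrite (uq_KK HA)|rewrite (uq_KK HB)].
- move=> i x hi; rewrite tens_op_comp // tens_op_id // => u /=.
    by rewrite (uq_KKV HA).
  by rewrite (uq_KKV HB).
- move=> i x hi; rewrite tens_op_comp // tens_op_id // => u /=.
    by rewrite (uq_KVK HA).
  by rewrite (uq_KVK HB).
- move=> i j x hi hj.
  rewrite !(lin_D (tens_op_lin _ _)) // !tens_op_comp //.
  have -> : tens_op (opKt A i \o opF A j) (opE B i \o opKtV B j) x =
      tens_op (opF A j \o opKt A i) (opKtV B j \o opE B i) x.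
    rewrite (@tens_op_eqZl _ _ _ (q ^ (- aij i j)) _ _
      (opF A j \o opKt A i) (opE B i \o opKtV B j)) //; last first.
      by move=> u /=; rewrite (uq_KtF q0 HA).
    rewrite (@tens_op_eqZr _ _ _ (q ^ (aij j i)) _ _
      (opF A j \o opKt A i) (opKtV B j \o opE B i)) //; last first.
      by move=> u /=; rewrite (uq_EKtV q0 HB).
    rewrite scalerA -expfzDr // (_ : _ + _ = 0) ?expr0z ?scale1r //.
    by rewrite /aij; lia.
  rewrite (_ : forall a b c d e f : {ffun I -> M},
    a + b + (c + d) - (e + c + (b + f)) = (a - e) + (d - f)); last first.
    move=> a b c d e f; apply/eqP; rewrite -subr_eq0; apply/eqP.
    rewrite -!scaleN1r; lquote_goal F [:: a; b; c; d; e; f].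
    by do 6?[case=> [_|]] => //=; ring.
  rewrite tens_op_subl tens_op_subr /=.
  case: eqP => [<-|/eqP neq_ij].
    rewrite (@tens_op_eqZl _ _ _ (q - q^-1)^-1 _ _
      (fun u => opKt A i u - opKtV A i u) (opKtV B i)) //; last first.
      by move=> u /=; rewrite (uq_EF HA) // eqxx.
    rewrite (@tens_op_eqZr _ _ _ (q - q^-1)^-1 (opKt A i)
      (fun b => opE B i (opF B i b) - opF B i (opE B i b))
      (opKt A i) (fun u => opKt B i u - opKtV B i u)) //; last first.
      by move=> u /=; rewrite (uq_EF HB) // eqxx.
    rewrite -scalerDr -tens_op_subl -tens_op_subr; congr (_ *: _).
    by rewrite addrC addrA subrK.
  rewrite tens_op_0l; last by move=> u; rewrite (uq_EF HA) // (negPf neq_ij).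
  by rewrite tens_op_0r ?addr0 // => u; rewrite (uq_EF HB) // (negPf neq_ij).
- move=> i j x hi hj; set c := q ^ _.
  rewrite (lin_D (tens_op_lin _ _)) // !tens_op_comp // scalerDr; congr (_ + _).
    by apply: tens_op_eqZl => // u /=; rewrite (uq_KE HA).
  apply: tens_op_eqZr => // u /=; last by rewrite (uq_KE HB).
  rewrite /opKt -(uq_KKVC HA); [|lia|lia].
  by rewrite (uq_KK HA) //; lia.
- move=> i j x hi hj; set c := q ^ _.
  rewrite (lin_D (tens_op_lin _ _)) // !tens_op_comp // scalerDr; congr (_ + _).
    apply: tens_op_eqZl => u /=; first by rewrite (uq_KF HA).
    rewrite /opKtV (uq_KKVC HB); [|lia|lia].
    by rewrite (uq_KK HB) //; lia.
  by apply: tens_op_eqZr => // u /=; rewrite (uq_KF HB).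
- split=> i j x hi hj hij.
    apply: serre_add; rewrite ?invr_eq0 //; try exact: tens_op_lin.
    + move=> y; rewrite !tens_op_comp //; apply: tens_op_eqZl => // u /=.
      by rewrite (uq_KtE q0 HA) // (_ : aij i i = 2%:Z) // /aij; lia.
    + move=> y; rewrite !tens_op_comp //; apply: tens_op_eqZl => // u /=.
      by rewrite (uq_KtE q0 HA) // (_ : aij i j = - 1%:Z) // /aij; lia.
    + move=> y; rewrite !tens_op_comp //; apply: tens_op_eqZl => // u /=.
      by rewrite (uq_KtE q0 HA) // (_ : aij j i = - 1%:Z) // /aij; lia.
    + move=> y; rewrite !tens_op_comp3 // tens_op_suml tens_op_0l // => u /=.
      by case: (uq_serreE HA) => [-> //].
    + move=> y; rewrite !tens_op_comp3 //.
      set f := fun u : {ffun I -> F^o} => opKt A i (opKt A i (opKt A j u)).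
      have e2 u : opKt A i (opKt A j (opKt A i u)) = f u.
        by rewrite [X in opKt A i X](uq_KtKt q0 HA).
      have e3 u : opKt A j (opKt A i (opKt A i u)) = f u.
        by rewrite (uq_KtKt q0 HA) // e2.
      rewrite (eq_tens_op _ e2 (frefl _)) (eq_tens_op _ e3 (frefl _)).
      rewrite tens_op_sumr tens_op_0r // => u /=.
      by case: (uq_serreE HB) => [-> //].
  have aij0 : aij i j = 0 by rewrite /aij; lia.
  have aji0 : aij j i = 0 by rewrite /aij; lia.
  rewrite !(lin_D (tens_op_lin _ _)) // !tens_op_comp // addrACA.
  congr (_ + _ + (_ + _));
    apply: eq_tens_op => u //=.
  - by case: (uq_serreE HA) => _ ->.
  - by rewrite (uq_KtE q0 HA) // aij0 expr0z scale1r.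
  - by rewrite (uq_KtE q0 HA) // aji0 expr0z scale1r.
  - by rewrite (uq_KtKt q0 HA).
  - by case: (uq_serreE HB) => _ ->.
- split=> i j x hi hj hij.
    rewrite (_ : q + q^-1 = q^-1 + q^-1^-1); last by rewrite invrK addrC.
    apply: serre_add; rewrite ?invr_eq0 //; try exact: tens_op_lin.
    + move=> y; rewrite !tens_op_comp //; apply: tens_op_eqZr => // u /=.
      rewrite (uq_FKtV q0 HB) // (_ : aij i i = 2%:Z) ?exprVn ?exprnN //.
      by rewrite /aij; lia.
    + move=> y; rewrite !tens_op_comp //; apply: tens_op_eqZr => // u /=.
      by rewrite (uq_FKtV q0 HB) // (_ : aij j i = - 1%:Z) ?invrK // /aij; lia.
    + move=> y; rewrite !tens_op_comp //; apply: tens_op_eqZr => // u /=.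
      by rewrite (uq_FKtV q0 HB) // (_ : aij i j = - 1%:Z) ?invrK // /aij; lia.
    + move=> y; rewrite !tens_op_comp3 //.
      set f := fun b : M => opKtV B i (opKtV B i (opKtV B j b)).
      have e2 u : opKtV B i (opKtV B j (opKtV B i u)) = f u.
        by rewrite [X in opKtV B i X](uq_KtVKtV q0 HB).
      have e3 u : opKtV B j (opKtV B i (opKtV B i u)) = f u.
        by rewrite (uq_KtVKtV q0 HB) // e2.
      rewrite (eq_tens_op _ (frefl _) e2) (eq_tens_op _ (frefl _) e3).
      rewrite tens_op_suml tens_op_0l // => u /=.
      by rewrite invrK [q^-1 + q]addrC; case: (uq_serreF HA) => [-> //].
    + move=> y; rewrite !tens_op_comp3 // tens_op_sumr tens_op_0r // => u /=.
      by rewrite invrK [q^-1 + q]addrC; case: (uq_serreF HB) => [-> //].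
  have aij0 : aij i j = 0 by rewrite /aij; lia.
  have aji0 : aij j i = 0 by rewrite /aij; lia.
  rewrite !(lin_D (tens_op_lin _ _)) // !tens_op_comp // addrACA.
  congr (_ + _ + (_ + _));
    apply: eq_tens_op => u //=.
  - by case: (uq_serreF HA) => _ ->.
  - by rewrite (uq_KtVKtV q0 HB).
  - by rewrite (uq_FKtV q0 HB) // aji0 expr0z scale1r.
  - by rewrite (uq_FKtV q0 HB) // aij0 expr0z scale1r.
  - by case: (uq_serreF HB) => _ ->.
Qed.

Lemma triv_uqP (F : fieldType) (q : F) (n : nat) :
  q != 0 -> is_uq_module q n (triv_uq F).
Proof.
move=> q0; have lin0 : linear (fun _ : F^o => 0 : F^o) by exact: lin_cst0.
split=> //=.
- by move=> i j x _ _; rewrite /opKt /opKtV /= !subrr scaler0; case: eqP.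
- by move=> i j x _ _; rewrite scaler0.
- by move=> i j x _ _; rewrite scaler0.
- by split=> // i j x _ _ _; rewrite scaler0 subr0 addr0.
- by split=> // i j x _ _ _; rewrite scaler0 subr0 addr0.
Qed.

Section VectorRep.
Variables (F : fieldType) (q : F) (n : nat).
Local Notation V := {ffun 'I_n -> F^o}.
Local Notation v := (vb F n).

Lemma vb_ord (k : 'I_n) : v k.+1 = basis_vec F k.
Proof. by apply/ffunP => l; rewrite !ffunE eqSS. Qed.

Lemma vb_out k : (k == 0)%N || (n < k)%N -> v k = 0.
Proof.
by move=> hk; apply/ffunP => l; rewrite !ffunE; case: eqP => //; have := ltn_ord l; lia.
Qed.

Lemma lin_ext_lin (f : nat -> V) : linear (lin_ext f).
Proof.
move=> a x y; rewrite /lin_ext scaler_sumr -big_split; apply: eq_bigr => k _.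
by rewrite /= !ffunE scalerDl scalerA.
Qed.

Lemma lin_ext_vb (f : nat -> V) k :
  ((k == 0)%N || (n < k)%N -> f k = 0) -> lin_ext f (v k) = f k.
Proof.
move=> fk; have [hk|] := boolP ((k == 0)%N || (n < k)%N).
  by rewrite fk // vb_out // (lin_0 (lin_ext_lin f)).
case: k fk => [//|k] _; rewrite -leqNgt => lt_kn.
rewrite /lin_ext (bigD1 (Ordinal lt_kn)) //= ffunE eqxx scale1r.
rewrite big1 ?addr0 // => l; rewrite -val_eqE /= ffunE eqSS => /negPf ->.
by rewrite scale0r.
Qed.

Lemma eq_on_vb (W : lmodType F) (f g : V -> W) : linear f -> linear g ->
  (forall k, f (v k) = g (v k)) -> f =1 g.
Proof.
move=> lf lg fg x; rewrite (basis_vecE x) !lin_sum //; apply: eq_bigr => k _.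
by rewrite (lin_Z lf) (lin_Z lg) -vb_ord fg.
Qed.

Lemma vec_E i k : (0 < i < n)%N ->
  opE (vec_uq q n) i (v k) = if k == i.+1 then v i else 0.
Proof.
by move=> hi; rewrite /= lin_ext_vb // => hk; case: eqP => // ?; subst k; lia.
Qed.

Lemma vec_F i k : (0 < i < n)%N ->
  opF (vec_uq q n) i (v k) = if k == i then v i.+1 else 0.
Proof.
by move=> hi; rewrite /= lin_ext_vb // => hk; case: eqP => // ?; subst k; lia.
Qed.

Lemma vec_K i k : opK (vec_uq q n) i (v k) = q ^ (k == i)%:Z *: v k.
Proof. by rewrite /= lin_ext_vb // => hk; rewrite vb_out ?scaler0. Qed.

Lemma vec_KV i k : opKV (vec_uq q n) i (v k) = q ^ (- (k == i)%:Z) *: v k.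
Proof. by rewrite /= lin_ext_vb // => hk; rewrite vb_out ?scaler0. Qed.

Lemma vec_uqP : q != 0 -> q ^+ 2 != 1 -> is_uq_module q n (vec_uq q n).
Proof.
move=> q0 q2; have dq : q - q^-1 != 0.
  apply: contra q2; rewrite subr_eq0 => /eqP eq_q.
  by rewrite expr2 {2}eq_q mulfV.
have lE i : linear (opE (vec_uq q n) i) by exact: lin_ext_lin.
have lF i : linear (opF (vec_uq q n) i) by exact: lin_ext_lin.
have lK i : linear (opK (vec_uq q n) i) by exact: lin_ext_lin.
have lKV i : linear (opKV (vec_uq q n) i) by exact: lin_ext_lin.
have EZ i := lin_Z (lE i); have FZ i := lin_Z (lF i).
have KZ i := lin_Z (lK i); have KVZ i := lin_Z (lKV i).
have E0 i := lin_0 (lE i); have F0 i := lin_0 (lF i).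
have K0 i := lin_0 (lK i); have KV0 i := lin_0 (lKV i).
have serre_lin (e : nat -> V -> V) i j : (forall i, linear (e i)) ->
    linear (fun x => e i (e i (e j x)) - (q + q^-1) *: e i (e j (e i x))
                     + e j (e i (e i x))).
  move=> le; apply: lin_add; first apply: lin_sub.
  - exact: (lin_comp (le i) (lin_comp (le i) (le j))).
  - by apply: lin_scale; exact: (lin_comp (le i) (lin_comp (le j) (le i))).
  - exact: (lin_comp (le j) (lin_comp (le i) (le i))).
have l0 := @lin_cst0 F V V.
split=> //.
- move=> i j x hi hj; move: x.
  apply: eq_on_vb; [exact: lin_comp|exact: lin_comp|move=> k].
  by rewrite !(vec_K, KZ) !scalerA mulrC.
- move=> i x hi; move: x; apply: eq_on_vb; [exact: lin_comp|by []|move=> k].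
  by rewrite !(vec_K, vec_KV, KZ) scalerA -expfzDr // addNr expr0z scale1r.
- move=> i x hi; move: x; apply: eq_on_vb; [exact: lin_comp|by []|move=> k].
  by rewrite !(vec_K, vec_KV, KVZ) scalerA -expfzDr // addrN expr0z scale1r.
- move=> i j x hi hj; move: x; apply: eq_on_vb => [||k].
  + by apply: lin_sub; exact: lin_comp.
  + case: (i == j); last exact: l0.
    by apply: lin_scale; apply: lin_sub; exact: lin_comp.
  rewrite vec_F // vec_E // /opKt /opKtV.
  rewrite !(vec_K, vec_KV, KZ, KVZ) !scalerA -!expfzDr // -scalerBl scalerA.
  rewrite (fun_if (opE (vec_uq q n) i)) (fun_if (opF (vec_uq q n) j)).
  rewrite vec_E // vec_F // E0 F0 eqSS (eq_sym j i).
  case: (i =P j) => [<-|/eqP neq_ij]; last by rewrite !if_same subrr.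
  case: (k =P i) => [->|/eqP/negPf neq_ki].
    have -> : (i == i.+1) = false by lia.
    by rewrite subr0 -[q ^ (_ + _)]/(q ^ 1) -[q ^ (_ - _)]/(q^-1) expr1z mulVf ?scale1r.
  case: (k =P i.+1) => [->|/eqP/negPf neq_ki1].
    rewrite sub0r -[q ^ (_ + _)]/(q^-1) -[q ^ (_ - _)]/(q ^ 1) expr1z.
    by rewrite -(opprB q) mulrN mulVf // scaleN1r.
  by rewrite !subrr mulr0 scale0r.
- move=> i j x hi hj; move: x; apply: eq_on_vb => [||k].
  + exact: lin_comp.
  + by apply: lin_scale; exact: lin_comp.
  rewrite vec_E // vec_K EZ vec_E //.
  case: eqP => [->|_]; last by rewrite K0 !scaler0.
  rewrite vec_K scalerA -expfzDr //; congr (q ^ _ *: _).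
  by rewrite !(eq_sym i); ring.
- move=> i j x hi hj; move: x; apply: eq_on_vb => [||k].
  + exact: lin_comp.
  + by apply: lin_scale; exact: lin_comp.
  rewrite vec_F // vec_K FZ vec_F //.
  case: eqP => [->|_]; last by rewrite K0 !scaler0.
  rewrite vec_K scalerA -expfzDr //; congr (q ^ _ *: _).
  by rewrite !(eq_sym i); ring.
- split=> i j x hi hj hij; move: x.
    apply: eq_on_vb => [||k]; [exact: serre_lin|exact: l0|].
    rewrite !(vec_E _ hi, vec_E _ hj, fun_if (opE (vec_uq q n) i),
      fun_if (opE (vec_uq q n) j), E0).
    by do ![case: eqP => ?; rewrite ?scaler0 ?subr0 ?addr0]; try lia.
  apply: eq_on_vb => [||k]; [exact: lin_comp|exact: lin_comp|].
  rewrite !(vec_E _ hi, vec_E _ hj, fun_if (opE (vec_uq q n) i),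
      fun_if (opE (vec_uq q n) j), E0).
  by do ![case: eqP => ?]; try lia.
- split=> i j x hi hj hij; move: x.
    apply: eq_on_vb => [||k]; [exact: serre_lin|exact: l0|].
    rewrite !(vec_F _ hi, vec_F _ hj, fun_if (opF (vec_uq q n) i),
      fun_if (opF (vec_uq q n) j), F0).
    by do ![case: eqP => ?; rewrite ?scaler0 ?subr0 ?addr0]; try lia.
  apply: eq_on_vb => [||k]; [exact: lin_comp|exact: lin_comp|].
  rewrite !(vec_F _ hi, vec_F _ hj, fun_if (opF (vec_uq q n) i),
      fun_if (opF (vec_uq q n) j), F0).
  by do ![case: eqP => ?]; try lia.
Qed.

End VectorRep.

Lemma tpow_uqP (F : fieldType) (q : F) (n r : nat) :
  q != 0 -> q ^+ 2 != 1 -> is_uq_module q n (tpow_uq q n r).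
Proof.
move=> q0 q2; elim: r => [|r IHr] /=; first exact: triv_uqP.
by apply: tens_uqP => //; apply: vec_uqP.
Qed.

Lemma tform_sym (F : fieldType) (n r : nat) (x y : tpow F n r) :
  tform x y = tform y x.
Proof.
elim: r x y => [|r IHr] x y /=; first by rewrite mulrC.
by apply: eq_bigr => k _.
Qed.

Lemma tform_linl (F : fieldType) (n r : nat) (y : tpow F n r) (a : F)
    (x x' : tpow F n r) : tform (a *: x + x') y = a * tform x y + tform x' y.
Proof.
elim: r y x x' => [|r IHr] y x x' /=.
  by rewrite mulrDl mulrA.
rewrite mulr_sumr -big_split; apply: eq_bigr => k _.
by rewrite !ffunE IHr.
Qed.

Lemma tform_linr (F : fieldType) (n r : nat) (y : tpow F n r) (a : F)
    (x x' : tpow F n r) : tform y (a *: x + x') = a * tform y x + tform y x'.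
Proof. by rewrite tform_sym tform_linl !(tform_sym y). Qed.

Lemma tform_0l (F : fieldType) (n r : nat) (y : tpow F n r) : tform 0 y = 0.
Proof. by have := tform_linl y (-1) 0 0; rewrite scaler0 addr0 mulN1r addNr. Qed.

Lemma tform_Zl (F : fieldType) (n r : nat) (y : tpow F n r) (a : F)
    (x : tpow F n r) : tform (a *: x) y = a * tform x y.
Proof. by rewrite -[a *: x]addr0 tform_linl tform_0l addr0. Qed.

Lemma tform_tens (F : fieldType) (n r : nat) (x : tpow F n r.+1) (a : 'I_n)
    (b : tpow F n r) : tform x (tens (basis_vec F a) b : tpow F n r.+1) =
  tform ((x : {ffun 'I_n -> tpow F n r}) a) b.
Proof.
rewrite /= (bigD1 a) //= ffunE ffunE eqxx scale1r big1 ?addr0 // => k /negPf nka.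
by rewrite !ffunE nka scale0r tform_sym tform_0l.
Qed.

Lemma tpow_basisS (F : fieldType) (n r : nat) (a : 'I_n) (t : r.-tuple 'I_n) :
  tpow_basis F [tuple of a :: t] =
  tens (basis_vec F a) (tpow_basis F t) :> {ffun 'I_n -> tpow F n r}.
Proof.
by rewrite /= vb_ord theadE; congr tens; congr tpow_basis; apply: val_inj.
Qed.

Lemma tform_basis (F : fieldType) (n r : nat) (s t : r.-tuple 'I_n) :
  tform (tpow_basis F s) (tpow_basis F t) = (s == t)%:R.
Proof.
elim: r s t => [|r IHr] s t; first by rewrite /= mulr1 (tuple0 s) (tuple0 t) eqxx.
case/tupleP: s => a s; case/tupleP: t => b t.
rewrite !tpow_basisS tform_tens ffunE tform_Zl IHr ffunE.
by rewrite -natrM mulnb eq_sym.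
Qed.

(* tpow_basis spans, so that the above characterises tform. *)
Lemma tpow_basis_span (F : fieldType) (n r : nat) (x : tpow F n r) :
  x = \sum_(t : r.-tuple 'I_n) tform x (tpow_basis F t) *: tpow_basis F t.
Proof.
elim: r x => [|r IHr] x.
  rewrite (big_pred1 [tuple]) => [|t]; last by rewrite /= (tuple0 t); exact/esym/eqP.
  by rewrite /= mulr1; exact/esym/mulr1.
rewrite (reindex (fun p : 'I_n * r.-tuple 'I_n => [tuple of p.1 :: p.2])); last first.
  exists (fun t => (thead t, behead_tuple t)) => [[a t]|t] _ /=.
    by rewrite theadE; congr (_, _); apply: val_inj.
  by rewrite [RHS]tuple_eta.
rewrite -(pair_bigA _ (fun (a : 'I_n) (t : r.-tuple 'I_n) => tform x (tpow_basis F [tuple of a :: t]) *: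
  tpow_basis F [tuple of a :: t])).
rewrite [LHS]tens_basisE; apply: eq_bigr => a _; rewrite [in LHS](IHr (x a)).
rewrite (lin_sum _ _ _ (tens_linr _)); apply: eq_bigr => t _.
by rewrite tpow_basisS tform_tens (lin_Z (tens_linr _)).
Qed.

(* Main.v *)
(* The vectors c_pi are maximal: inductively E_1 Psi_j b = Psi_(j-1)^+ b and
   E_i Psi_j b = 0 for i > 1, so the terms of Delta(E_i) Phi_m(b) cancel in pairs.
   Each K_i is self-adjoint for the form, and the adjoint of E_i is q^-1 F_i Kt_i,
   so a maximal vector w is orthogonal to the image of every F_i.  Expanding
   Phi_m(b) modulo these images gives <w, Phi_m(b)> = C <w, v_m (x) b> with C a
   power of q times a product of quotients [D + 1] / [D], D > 0.  For
   w = Phi_m'(b') with m' <= m the right-hand side is C <b', b> if m' = m, and 0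
   otherwise, since Phi_m'(b') lies in v_m' (x) b' + sum_(k < m') v_k (x) M.
   Vectors of different weights are orthogonal, so induction on r concludes. *)
Require Import Defs.
From mathcomp Require Import all_boot all_order all_algebra.
From mathcomp Require Import ring zify.
Set Implicit Arguments.
Unset Strict Implicit.
Unset Printing Implicit Defensive.
Import Order.TTheory GRing.Theory Num.Theory.
Local Open Scope ring_scope.

(** * Quantum integers and a telescoping sum *)

Section QuantumIntegers.
Variables (F : fieldType) (q : F).
Hypotheses (q_neq0 : q != 0) (q_nroot : forall k, (0 < k)%N -> q ^+ k != 1).

Lemma expz_eq1 (a : int) : q ^ a = 1 -> a = 0.
Proof.
case: a => [[|k]|k] //.
  by move/eqP; rewrite -exprnP (negPf (q_nroot _)).
by move/eqP; rewrite NegzE -exprnN invr_eq1 (negPf (q_nroot _)).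
Qed.

Lemma expz_inj : injective (fun a : int => q ^ a).
Proof.
move=> a b /= eq_ab; apply/eqP; rewrite -subr_eq0; apply/eqP; apply: expz_eq1.
by rewrite expfzDr // eq_ab -expfzDr // subrr.
Qed.

Lemma q_subV_neq0 : q - q^-1 != 0.
Proof.
rewrite subr_eq0; apply/eqP; rewrite -[X in X = _]expr1z -exprN1 => /expz_inj.
by [].
Qed.

Lemma qint_neq0 a : a != 0 -> qint q a != 0.
Proof.
move=> a0; rewrite /qint mulf_neq0 ?invr_eq0 ?q_subV_neq0 // subr_eq0.
apply/eqP => /expz_inj; move: a0; lia.
Qed.

Lemma qint0 : qint q 0 = 0.
Proof. by rewrite /qint subrr mul0r. Qed.

Lemma qintN1 : qint q (-1) = -1.
Proof. by rewrite /qint opprK exprN1 expr1z -opprB mulNr mulfV // q_subV_neq0. Qed.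

(** On expanding into powers of [q], the terms [q ^ (c - a - 1)] and [q ^ (a + 1 - c)] cancel. This
    collapses the scalar that [e 1] produces on the recursion for Psi. *)
Lemma qint_addE a c :
  qint q c * qint q (a + 1) - qint q (c - 1) * qint q a = qint q (c + a).
Proof.
rewrite /qint !opprD !opprK !expfzDr // !exprN1 !expr1z -!invr_expz.
have := q_subV_neq0; have := expfz_neq0 a q_neq0; have := expfz_neq0 c q_neq0.
move: (q ^ a) (q ^ c) => x y x0 y0 dq.
have q2 : q * q - 1 != 0 by rewrite subr_eq0 -expr2 q_nroot.
by field; rewrite ?q_neq0 ?x0 ?y0 -?expr2 ?q2.
Qed.

Lemma qintS a : qint q (a + 1) = q * qint q a + q ^ (- a).
Proof.
rewrite /qint !opprD !expfzDr // !exprN1 !expr1z -!invr_expz.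
have := q_subV_neq0; have := expfz_neq0 a q_neq0.
move: (q ^ a) => x x0 dq.
have q2 : q * q - 1 != 0 by rewrite subr_eq0 -expr2 q_nroot.
by field; rewrite ?q_neq0 ?x0 -?expr2 ?q2.
Qed.

(** Adding the next term multiplies the right-hand side by [1 + q^-1 q^(-D) / [D]], which [qintS]
    turns into [q^-1 [D + 1] / [D]]. *)
Lemma qint_telescope (D : nat -> int) m :
  (forall k, (0 < k <= m)%N -> qint q (D k) != 0) ->
  1 + \sum_(j < m) q^-1 ^+ j.+1 *
      (q ^ (- D j.+1) / qint q (D j.+1) *
       \prod_(k < j) (qint q (D k.+1 + 1) / qint q (D k.+1))) =
  q^-1 ^+ m * \prod_(k < m) (qint q (D k.+1 + 1) / qint q (D k.+1)).
Proof.
elim: m => [|m IHm] D0; first by rewrite !big_ord0 mulr1 addr0.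
rewrite !big_ord_recr /= addrA IHm => [|k hk]; last by apply: D0; lia.
have := D0 m.+1; rewrite leqnn => /(_ isT) Dm; rewrite qintS exprS.
by move: (\prod_(k < m) _) => P; field; rewrite q_neq0 Dm.
Qed.

End QuantumIntegers.

(** * Relations that survive a shift of the generators *)

Section LadderDef.
Variables (F : fieldType) (q : F) (M : lmodType F).

(* What remains of the relations of U_q(sl_(N+1)) when [wt i a x] stands for
   "x has weight a for Kt_i"; unlike a module structure, this is stable under
   the shift of indices. *)
Record ladder (N : nat) (e f : nat -> M -> M) (wt : nat -> int -> M -> Prop) :
    Prop := Ladder {
  ladder_linE : forall i, linear (e i);
  ladder_linF : forall i, linear (f i);
  ladder_EFneq : forall i j x, (0 < i <= N)%N -> (0 < j <= N)%N -> i != j ->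
    e i (f j x) = f j (e i x);
  ladder_EF : forall i a x, (0 < i <= N)%N -> wt i a x ->
    e i (f i x) = f i (e i x) + qint q a *: x;
  ladder_FF : forall i j x, (0 < i <= N)%N -> (0 < j <= N)%N -> (i.+1 < j)%N ->
    f i (f j x) = f j (f i x);
  ladder_wtF : forall i j a x, (0 < i <= N)%N -> (0 < j <= N)%N -> i != j ->
    wt i a x -> wt i (a + ((i == j.+1) || (j == i.+1))%:Z) (f j x);
  ladder_wtZ : forall i a c x, wt i a x -> wt i a (c *: x);
  ladder_wtB : forall i a x y, wt i a x -> wt i a y -> wt i a (x - y)
}.

Lemma ladder_shift k N e f wt :
  ladder N e f wt -> ladder (N - k) (shift k e) (shift k f) (shift k wt).
Proof.
case=> lE lF EFn EF FF wF wZ wB; split; rewrite /shift //.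
- by move=> i j x hi hj hij; apply: EFn; lia.
- by move=> i a x hi; apply: EF; lia.
- by move=> i j x hi hj hij; apply: FF; lia.
- move=> i j a x hi hj hij hx.
  rewrite (_ : (_ || _) = (i + k == (j + k).+1) || (j + k == (i + k).+1))%N; last by lia.
  by apply: wF => //; lia.
- by move=> i a c x; apply: wZ.
- by move=> i a x y; apply: wB.
Qed.

End LadderDef.

(** * The elements Psi and the raising operators *)

Section PsiGeneral.
Variables (F : fieldType) (q : F) (M : lmodType F).
Hypotheses (q_neq0 : q != 0) (q_nroot : forall k, (0 < k)%N -> q ^+ k != 1).
Implicit Types (f : nat -> M -> M) (lam : nat -> int) (x : M).

(* Since [c_1] = 0 and [c_1 - 1] = -1, the recursion also covers Psi_1. *)
Lemma PsiS f lam j x :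
  Psi q f lam j.+1 x =
  (qint q (dd lam j.+1))^-1 *:
    (qint q (cc lam j.+1) *: f 1%N (Psi q (shift 1 f) (shift 1 lam) j x)
     - qint q (cc lam j.+1 - 1) *: Psi q (shift 1 f) (shift 1 lam) j (f 1%N x)).
Proof.
by case: j => [|j] //=; rewrite qint0 sub0r qintN1 // scale0r scaleN1r opprK add0r.
Qed.

(** Needed because [shift 1 (shift k f)] and [shift k.+1 f] agree only pointwise. *)
Lemma eq_Psi f f' lam lam' j x :
  (forall i y, f i y = f' i y) -> lam =1 lam' -> Psi q f lam j x = Psi q f' lam' j x.
Proof.
elim: j f f' lam lam' x => [//|j IHj] f f' lam lam' x ef el.
have IH y : Psi q (shift 1 f) (shift 1 lam) j y = Psi q (shift 1 f') (shift 1 lam') j y.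
  by apply: IHj => [i z|i]; rewrite /shift.
by rewrite !PsiS !IH !ef /cc /dd !el.
Qed.

Lemma Psi_lin f lam j : (forall i, linear (f i)) -> linear (Psi q f lam j).
Proof.
elim: j f lam => [//|j IHj] f lam lf a x y; rewrite !PsiS.
have lP : linear (Psi q (shift 1 f) (shift 1 lam) j) by apply: IHj => i; exact: lf.
set c := (qint _ _)^-1; have := @lin_scale F M M c _
  (lin_sub (lin_scale (qint q (cc lam j.+1)) (lin_comp (lf 1%N) lP))
     (lin_scale (qint q (cc lam j.+1 - 1)) (lin_comp lP (lf 1%N)))).
by apply.
Qed.

Lemma Psi_comm (h : M -> M) f lam j x : linear h ->
  (forall i y, (0 < i <= j)%N -> h (f i y) = f i (h y)) ->
  h (Psi q f lam j x) = Psi q f lam j (h x).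
Proof.
move=> lh; elim: j f lam x => [//|j IHj] f lam x hf; rewrite !PsiS.
have IH y : h (Psi q (shift 1 f) (shift 1 lam) j y) =
    Psi q (shift 1 f) (shift 1 lam) j (h y).
  by apply: IHj => i z hi; rewrite /shift hf //; lia.
by rewrite (lin_Z lh) (lin_B lh) !(lin_Z lh) hf // !IH hf.
Qed.

(* Psi_j is a combination of products of f_1, ..., f_j, each occurring once. *)
Lemma Psi_grade (P : int -> M -> Prop) (g : nat -> int) f lam j a x :
  (forall a c y, P a y -> P a (c *: y)) ->
  (forall a y z, P a y -> P a z -> P a (y - z)) ->
  (forall i a y, (0 < i <= j)%N -> P a y -> P (a + g i) (f i y)) ->
  P a x -> P (a + \sum_(i < j) g i.+1) (Psi q f lam j x).
Proof.
move=> PZ PB; elim: j f lam g a x => [|j IHj] f lam g a x Pf Pa.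
  by rewrite big_ord0 addr0.
have IH b y : P b y ->
    P (b + \sum_(i < j) g i.+2) (Psi q (shift 1 f) (shift 1 lam) j y).
  move=> Pb; apply: (IHj _ _ (fun i => g i.+1)) => // i b' z hi Pz.
  by rewrite /shift addn1; apply: Pf => //; lia.
rewrite PsiS big_ord_recl /=; apply: (PZ); apply: (PB); apply: (PZ).
  rewrite addrCA addrC.
  by apply: Pf => //; apply: IH.
by rewrite addrA; apply: IH; apply: Pf.
Qed.

(** Every monomial of [Psi_(j+1)] is nonempty, so its outermost factor is some [f i], which [L]
    kills. *)
Lemma Psi_kill (W : lmodType F) (L : M -> W) f lam j x : linear L ->
  (forall i y, (0 < i <= j.+1)%N -> L (f i y) = 0) -> L (Psi q f lam j.+1 x) = 0.
Proof.
move=> lL; elim: j f lam x => [|j IHj] f lam x Lf.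
  by rewrite /= (lin_Z lL) Lf // scaler0.
rewrite PsiS (lin_Z lL) (lin_B lL) !(lin_Z lL) Lf // IHj ?scaler0 ?subrr ?scaler0 //.
by move=> i y hi; rewrite /shift Lf //; lia.
Qed.

(** Makes the quotient in [Psi_E1] equal to 1 when [a] is the weight prescribed by [lam]. *)
Lemma cc_dd lam j : cc lam j.+1 + (lam 1%N - lam 2%N) = dd lam j.+1.
Proof. by rewrite /cc /dd; case: j => [|j] /=; ring. Qed.

Lemma ccS lam j : cc lam j.+2 = dd (shift 1 lam) j.+1 + 1.
Proof. by rewrite /cc /dd /shift /= !addn1 (intS j.+1); ring. Qed.

Section Ladder.
Variables (N : nat) (e f : nat -> M -> M) (wt : nat -> int -> M -> Prop).
Hypothesis (Hl : ladder q N e f wt).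

(** Among [f 2, ..., f j.+1] only [f 2] changes the weight for [Kt_1], and it occurs once as soon as
    [j > 0]. *)
Lemma Psi_wt1 lam j a x : (j < N)%N -> wt 1%N a x ->
  wt 1%N (a + (0 < j)%N%:Z) (Psi q (shift 1 f) lam j x).
Proof.
move=> hj hx.
have -> : (0 < j)%N%:Z = \sum_(i < j) (i.+1 == 1%N)%:Z.
  case: j {hj} => [|j]; first by rewrite big_ord0.
  by rewrite big_ord_recl big1.
apply: (@Psi_grade (wt 1%N) (fun i => (i == 1%N)%:Z)) => //.
- by move=> b c y; apply: ladder_wtZ Hl _ _ _ _.
- by move=> b y z; apply: ladder_wtB Hl _ _ _ _.
move=> i b y hi hy; rewrite /shift.
rewrite (_ : (i == 1) = (1 == (i + 1).+1) || (i + 1 == 2))%N; last by lia.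
by apply: (ladder_wtF Hl) => //; lia.
Qed.

(** Since [e 1] commutes with the shifted Psi and kills [x], only its commutators with [f 1] remain:
    [[a + 1]] from the first summand and [[a]] from the second. Then [qint_addE] applies. *)
Lemma Psi_E1 lam j a x : (j < N)%N -> wt 1%N a x -> e 1%N x = 0 ->
  e 1%N (Psi q f lam j.+1 x) =
  (qint q (cc lam j.+1 + a) / qint q (dd lam j.+1)) *:
    Psi q (shift 1 f) (shift 1 lam) j x.
Proof.
move=> hj hx ex.
have lE := ladder_linE Hl; have lF := ladder_linF Hl.
have lP : linear (Psi q (shift 1 f) (shift 1 lam) j) by apply: Psi_lin => i; exact: lF.
have eP y : e 1%N (Psi q (shift 1 f) (shift 1 lam) j y) =
    Psi q (shift 1 f) (shift 1 lam) j (e 1%N y).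
  by apply: Psi_comm => // i z hi; rewrite /shift (ladder_EFneq Hl) //; lia.
rewrite PsiS (lin_Z (lE _)) (lin_B (lE _)) !(lin_Z (lE _)) eP.
rewrite (ladder_EF Hl _ hx) ?(ladder_EF Hl _ (Psi_wt1 _ hj hx)); [|lia|lia].
rewrite eP ex (lin_0 lP) (lin_0 (lF _)) !add0r (lin_Z lP) !scalerA -scalerBl.
rewrite scalerA [_^-1 * _]mulrC -[in RHS]qint_addE //; congr ((_ - _) / _ *: _).
(* For [j = 0] no [f 2] raises the weight, but then the coefficient [[c_1]] is zero. *)
case: j {hj lP eP} => [|j] //=.
by rewrite qint0 !mul0r.
Qed.

Lemma Psi_E1_max lam j x : (j < N)%N -> wt 1%N (lam 1%N - lam 2%N) x -> e 1%N x = 0 ->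
  dd lam j.+1 != 0 ->
  e 1%N (Psi q f lam j.+1 x) = Psi q (shift 1 f) (shift 1 lam) j x.
Proof.
move=> hj hx ex d0; rewrite (Psi_E1 _ hj hx ex) cc_dd mulfV ?scale1r //.
exact: qint_neq0.
Qed.

End Ladder.

(* The weight of x for Kt_1 is irrelevant here: this is what makes the induction
   pass from x to f_1 x, whose weight for Kt_2 is off by one. *)
Lemma Psi_Egt1 N e f wt lam j i x : ladder q N e f wt -> (j <= N)%N -> (1 < i <= N)%N ->
  (forall k, (0 < k <= N)%N -> e k x = 0) ->
  (forall k, (1 < k <= N)%N -> wt k (lam k - lam k.+1) x) ->
  (forall k, (0 < k <= j)%N -> lam k - lam j.+1 + j%:Z - k%:Z != 0) ->
  e i (Psi q f lam j x) = 0.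
Proof.
elim: j i N e f wt lam x => [|j IHj] i N e f wt lam x Hl hj hi ex wx d0.
  by rewrite /= ex //; lia.
have lE := ladder_linE Hl; have lF := ladder_linF Hl.
have Hl1 := ladder_shift 1 Hl.
have ef1 : e i (f 1%N x) = 0.
  by rewrite (ladder_EFneq Hl) ?ex ?(lin_0 (lF _)) //; lia.
rewrite PsiS (lin_Z (lE _)) (lin_B (lE _)) !(lin_Z (lE _)).
rewrite (ladder_EFneq Hl); [|lia|lia|lia].
have e1x k : (0 < k <= N - 1)%N -> shift 1 e k (f 1%N x) = 0.
  by move=> hk; rewrite /shift (ladder_EFneq Hl) ?ex ?(lin_0 (lF _)) //; lia.
(* For [i > 2] the summands vanish separately, by induction at [x] and at [f 1 x], which has the
   same weight as [x] for each [Kt_k] with [k > 2]. *)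
have [hi2|/eqP i2] := boolP (2 < i)%N.
  have ei : e i = shift 1 e i.-1 by rewrite /shift; congr e; lia.
  rewrite ei !(IHj _ (N - 1)%N _ _ (shift 1 wt)) ?(lin_0 (lF _)) //
    ?scaler0 ?subrr ?scaler0 //; try lia.
  - move=> k hk; rewrite /shift -[_ - _]addr0.
    rewrite (_ : 0 = ((k + 1 == 2) || (1 == (k + 1).+1))%N%:Z); last by lia.
    apply: (ladder_wtF Hl); try lia.
    by rewrite !addn1; apply: wx; lia.
  - by move=> k hk; have := d0 k.+1; rewrite /shift !addn1; lia.
  - by move=> k hk; rewrite /shift; apply: ex; lia.
  - by move=> k hk; rewrite /shift !addn1; apply: wx; lia.
  - by move=> k hk; have := d0 k.+1; rewrite /shift !addn1; lia.
have {}i2 : i = 2%N by lia.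
subst i; case: j IHj hj d0 => [|j] IHj hj d0.
  by rewrite /= ex ?ef1 ?(lin_0 (lF _)) ?scaler0 ?subrr ?scaler0 //; lia.
(* For [i = 2] the summands cancel. On [f 1 x] the weight for [Kt_2] is one higher, so [e 2] yields
   the factor [[d + 1] / [d]], where [d] is this [dd]. As [c_(j+2) = d + 1], both terms carry
   [[d + 1]], and [f 1] commutes with the twice shifted Psi. *)
have d1 : dd (shift 1 lam) j.+1 != 0.
  by have := d0 2%N; rewrite /dd /shift !addn1; lia.
rewrite -[e 2%N]/(shift 1 e 1%N).
rewrite (Psi_E1_max Hl1) //; [|lia|by apply: wx; lia|by apply: ex; lia].
rewrite (@Psi_E1 _ _ _ _ Hl1 _ _ (lam 2%N - lam 3%N + 1)); first last.
- by [].
- by apply: (@ladder_wtF _ _ _ _ _ _ _ Hl 2%N 1%N); try lia; apply: wx; lia.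
- by lia.
rewrite addrA (cc_dd (shift 1 lam)) ccS addrK.
rewrite scalerA mulrC divfK ?qint_neq0 //.
rewrite -(Psi_comm (h := f 1%N)) ?subrr ?scaler0 //.
by move=> k y hk; rewrite /shift (ladder_FF Hl) //; lia.
Qed.

End PsiGeneral.

(** [L i] stands for pairing [v_i (x) -] with a maximal vector. In the recursion for Psi the summand
    with [f 1] innermost dies, its outer factors being [f i] with [i > 1]; the other turns [L 1]
    into [L 2]. Each stage contributes [- q ^ (- a) [c] / [d]], with [c] and [d] read off from
    [D]. *)
Lemma Psi_form (F : fieldType) (q : F) (M : lmodType F) N e f wt (lam D : nat -> int)
    (L : nat -> M -> F^o) j x :
  q != 0 -> (forall k, (0 < k)%N -> q ^+ k != 1) ->
  ladder q N e f wt -> (j < N)%N ->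
  (forall i, linear (L i)) ->
  (forall i k y, (0 < i <= N)%N -> (0 < k <= N)%N -> i != k -> L i (f k y) = 0) ->
  (forall i a y, (0 < i <= N)%N -> wt i a y -> L i (f i y) = - (q ^ (- a) * L i.+1 y)) ->
  (forall k, (0 < k <= N)%N -> wt k (lam k - lam k.+1) x) ->
  (forall k, (0 < k <= j.+1)%N -> D k = lam (j.+2 - k)%N - lam j.+2 + k%:Z - 1) ->
  L 1%N (Psi q f lam j.+1 x) =
  (-1) ^+ j.+1 * (q ^ (- D j.+1) / qint q (D j.+1) *
    \prod_(k < j) (qint q (D k.+1 + 1) / qint q (D k.+1))) * L j.+2 x.
Proof.
have sE (a b : F) : a *: (b : F^o) = a * b by [].
move=> q0 qn; elim: j N e f wt lam L => [|j IHj] N e f wt lam L Hl hj lL Lneq Leq wx defD.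
  rewrite /= (lin_Z (lL _)) (Leq _ (lam 1%N - lam 2%N)) //; last by apply: wx; lia.
  rewrite big_ord0 defD // subSS subn0 /dd !(addrK 1) sE.
  by move: (L _ x) (q ^ _) (qint q _)^-1 => l A B; ring.
rewrite PsiS // (lin_Z (lL _)) (lin_B (lL _)) !(lin_Z (lL _)).
rewrite (Psi_kill q0 qn (L := L 1%N)) //; last first.
  by move=> i y hi; rewrite /shift Lneq //; lia.
(* The extra 1 in the weight comes from the factor [f 2] of the shifted Psi. *)
rewrite scaler0 subr0 (Leq _ (lam 1%N - lam 2%N + 1)); [|lia|]; last first.
  by apply: (@Psi_wt1 _ _ _ q0 qn _ _ _ _ Hl _ j.+1) => //; apply: wx; lia.
rewrite -[L 2%N]/(shift 1 L 1%N).
rewrite (IHj _ _ _ _ _ _ (ladder_shift 1 Hl)); first last.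
- move=> k hk; rewrite /shift !addn1 defD; last lia.
  by rewrite (_ : (j.+3 - k = (j.+2 - k).+1)%N) //; lia.
- by move=> k hk; rewrite /shift !addn1; apply: wx; lia.
- by move=> i a y hi; rewrite /shift; apply: Leq; lia.
- by move=> i k y hi hk ik; rewrite /shift; apply: Lneq; lia.
- by move=> i; exact: lL.
- by lia.
rewrite ccS (_ : dd (shift 1 lam) j.+1 = D j.+1); last first.
  rewrite defD; last lia.
  by rewrite /dd /shift !addn1 (_ : (j.+3 - j.+1)%N = 2%N) //; lia.
have dD : dd lam j.+2 = D j.+2.
  by rewrite defD ?leqnn // (_ : (j.+3 - j.+2)%N = 1%N) //; lia.
rewrite dD big_ord_recr /shift addn1 /=.
have -> : q ^ (- D j.+2) = q ^ (- (lam 1%N - lam 2%N + 1)) * q ^ (- D j.+1).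
  rewrite -expfzDr // !defD; [|lia|lia]; congr (q ^ _).
  rewrite (_ : (j.+3 - j.+2)%N = 1%N); last lia.
  rewrite (_ : (j.+3 - j.+1)%N = 2%N); last lia.
  by rewrite (intS j.+1); ring.
rewrite !sE [in RHS]exprS.
move: (L _ x) (\prod_(_ < _) _) (q ^ _) (q ^ _) (qint q _)^-1 (qint q _)^-1 => l P A B C E.
by ring.
Qed.

(** * Weight vectors and maximal vectors in modules *)

Section Modules.
Variables (F : fieldType) (M : lmodType F) (q : F) (n : nat) (A : uq_ops M).
Hypotheses (q_neq0 : q != 0) (HA : is_uq_module q n A).

Definition has_weight (mu : nat -> int) (x : M) : Prop :=
  forall i, (0 < i <= n)%N -> opK A i x = q ^ mu i *: x.

Definition maximal (mu : nat -> int) (x : M) : Prop :=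
  has_weight mu x /\ forall i, (0 < i < n)%N -> opE A i x = 0.

(** Both operators are prescribed, so that the commutator of [E_i] and [F_i] acts directly as
    [[a]]. *)
Definition Kt_weight (i : nat) (a : int) (x : M) : Prop :=
  opKt A i x = q ^ a *: x /\ opKtV A i x = q ^ (- a) *: x.

Lemma opKV_weight i a x : (0 < i <= n)%N -> opK A i x = q ^ a *: x ->
  opKV A i x = q ^ (- a) *: x.
Proof.
move=> hi /(exprz_cancel q_neq0) Kx; rewrite [in LHS]Kx.
by rewrite (lin_Z (uq_linKV HA _)) (uq_KVK HA).
Qed.

Lemma has_weight_Kt mu x i : has_weight mu x -> (0 < i < n)%N ->
  Kt_weight i (mu i - mu i.+1) x.
Proof.
move=> hx hi; have [hi1 hi2] : (0 < i <= n)%N /\ (0 < i.+1 <= n)%N by lia.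
have lK := uq_linK HA; have lKV := uq_linKV HA.
split; rewrite /opKt /opKtV.
  rewrite (opKV_weight hi2 (hx _ hi2)) (lin_Z (lK _)) hx // scalerA.
  by rewrite -expfzDr // addrC.
rewrite (hx _ hi2) (lin_Z (lKV _)) (opKV_weight hi1 (hx _ hi1)) scalerA.
by rewrite -expfzDr // opprB.
Qed.

Lemma uq_ladder : ladder q n.-1 (opE A) (opF A) Kt_weight.
Proof.
have lKt := opKt_lin HA; have lKtV := opKtV_lin HA; have lF := uq_linF HA.
split.
- exact: uq_linE HA.
- exact: uq_linF HA.
- move=> i j x hi hj /negPf ij; have := uq_EF HA x (i := i) (j := j).
  by rewrite ij => /(_ _ _)/eqP; rewrite subr_eq0 => E; apply/eqP/E; lia.
- move=> i a x hi [ex eVx]; have := uq_EF HA x (i := i) (j := i).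
  rewrite eqxx ex eVx -scalerBl scalerA => E.
  apply/eqP; rewrite addrC -subr_eq E /qint; [|lia|lia].
  by rewrite mulrC.
- by move=> i j x hi hj hij; case: (uq_serreF HA) => _ FF; apply: FF; lia.
- move=> i j a x hi hj hij [ex eVx].
  have aE : ((i == j.+1) || (j == i.+1))%:Z = - aij i j.
    rewrite /aij eqSS (negPf hij) [j == _]eq_sym.
    by case: (i =P j.+1) => [->|_]; case: (_ =P j) => //; lia.
  split.
    rewrite (uq_KtF q_neq0 HA); [|lia|lia].
    by rewrite ex (lin_Z (lF _)) scalerA -expfzDr // aE addrC.
  rewrite (uq_KtVF q_neq0 HA); [|lia|lia].
  by rewrite eVx (lin_Z (lF _)) scalerA -expfzDr // aE opprD opprK addrC.
- move=> i a c x [ex eVx].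
  by split; rewrite ?(lin_Z (lKt _)) ?(lin_Z (lKtV _)) ?ex ?eVx !scalerA mulrC.
- move=> i a x y [ex eVx] [ey eVy].
  by split; rewrite ?(lin_B (lKt _)) ?(lin_B (lKtV _)) ?ex ?eVx ?ey ?eVy -scalerBr.
Qed.

End Modules.

(** * Maximality of the vectors Phi *)

Section PhiMaximal.
Variables (F : fieldType) (M : lmodType F) (q : F) (n : nat) (A : uq_ops M).
Hypotheses (q_neq0 : q != 0) (q_nroot : forall k, (0 < k)%N -> q ^+ k != 1).
Hypothesis (HA : is_uq_module q n A).

Lemma Psi_weight mu lam k j x : has_weight q n A mu x -> (k + j < n)%N ->
  has_weight q n A (fun i => mu i + (i == k + j.+1)%N%:Z - (i == k.+1)%:Z)
    (Psi q (shift k (opF A)) lam j x).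
Proof.
move=> hx hkj i hi.
(* [g t] is the change of weight for [K_i] caused by [F_(t+k)]; its sum over [t] telescopes. *)
pose g t : int := (i == (t + k).+1)%:Z - (i == t + k)%N%:Z.
have -> : mu i + (i == k + j.+1)%N%:Z - (i == k.+1)%:Z = mu i + \sum_(t < j) g t.+1.
  rewrite -addrA; congr (_ + _); elim: j {hkj} => [|j IHj].
    by rewrite big_ord0 addn1 subrr.
  by rewrite big_ord_recr -IHj /g /= addnC addSn [(j.+1 + k)%N]addnC addnS; ring.
apply: (@Psi_grade _ q M q_neq0 q_nroot (fun a y => opK A i y = q ^ a *: y)) => //.
- by move=> a c y Ky; rewrite (lin_Z (uq_linK HA i)) Ky !scalerA mulrC.
- by move=> a y z Ky Kz; rewrite (lin_B (uq_linK HA i)) Ky Kz scalerBr.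
- move=> t a y ht Ky; rewrite /shift (uq_KF HA) //; last lia.
  rewrite Ky (lin_Z (uq_linF HA _)) scalerA -expfzDr //; congr (q ^ _ *: _).
  by rewrite /g; ring.
- exact: hx.
Qed.

(** For [i <= k], [E_i] commutes with every generator in Psi; [i = k + 1] is [Psi_E1_max] and
    [i > k + 1] is [Psi_Egt1]. The strict inequalities keep the denominators nonzero. *)
Lemma Psi_E mu k j i x : maximal q n A mu x -> (k + j < n)%N -> (0 < i < n)%N ->
  (forall t, (k < t <= k + j)%N -> mu (k + j).+1 < mu t) ->
  opE A i (Psi q (shift k (opF A)) (shift k mu) j x) =
  if (i == k.+1) && (0 < j)%N then Psi q (shift k.+1 (opF A)) (shift k.+1 mu) j.-1 x
  else 0.
Proof.
move=> [wx ex] hkj hi hmu.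
have Hl := uq_ladder q_neq0 HA; have lF := uq_linF HA.
have Hlk := ladder_shift k Hl.
have [le_ik|lt_ki] := leqP i k.
  rewrite (_ : (i == k.+1) = false); last lia.
  rewrite (Psi_comm q_neq0 q_nroot) ?ex //; first last.
  - by move=> t y ht; rewrite /shift (ladder_EFneq Hl) //; lia.
  - exact: uq_linE HA i.
  by rewrite (lin_0 (Psi_lin q_neq0 q_nroot _ _ (fun t => lF _))).
have [->|neq_ik] := eqVneq i k.+1; last first.
  rewrite (_ : opE A i = shift k (opE A) (i - k)); last by rewrite /shift subnK // ltnW.
  apply: (Psi_Egt1 q_neq0 q_nroot Hlk); try lia.
  - by move=> t ht; rewrite /shift ex //; lia.
  - by move=> t ht; rewrite /shift addSn; apply: (has_weight_Kt q_neq0 HA) => //; lia.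
  - move=> t ht; have := hmu (t + k)%N; rewrite /shift addSn [(j + k)%N]addnC; lia.
case: j hkj hmu => [|j] hkj hmu /=; first by apply: ex; lia.
rewrite -[opE A k.+1]/(shift k (opE A) 1%N).
rewrite (Psi_E1_max q_neq0 q_nroot Hlk); first last.
- have := hmu k.+1; rewrite /dd /shift !addSn [(j + k)%N]addnC !addnS add0n.
  by move=> /(_ _); lia.
- by rewrite /shift ex //; lia.
- by rewrite /shift; apply: (has_weight_Kt q_neq0 HA) => //; lia.
- by lia.
by apply: (eq_Psi q_neq0 q_nroot) => [t y|t]; rewrite /shift addn1 ?addSnnS.
Qed.

Local Notation V := (vec_uq q n).

Let q2_neq1 : q ^+ 2 != 1. Proof. exact: q_nroot. Qed.
Let HV := vec_uqP n q_neq0 q2_neq1.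

Lemma vec_Kt i k : opKt V i (vb F n k) = q ^ ((k == i)%:Z - (k == i.+1)%:Z) *: vb F n k.
Proof.
rewrite /opKt vec_KV (lin_Z (uq_linK HV i)) vec_K scalerA -expfzDr //.
by rewrite addrC.
Qed.

Lemma opK_tens i u x : opK (tens_uq V A) i (tens u x) = tens (opK V i u) (opK A i x).
Proof. by rewrite /= tens_op_tens //; [exact: uq_linK HV i|exact: uq_linK HA i]. Qed.

Lemma opE_tens i u x : opE (tens_uq V A) i (tens u x) =
  tens (opE V i u) x + tens (opKt V i u) (opE A i x).
Proof.
transitivity (tens_op (opE V i) id (tens u x) + tens_op (opKt V i) (opE A i) (tens u x)) => //.
rewrite !tens_op_tens //; [exact: opKt_lin HV i|exact: uq_linE HA i|exact: uq_linE HV i].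
Qed.

Lemma opF_tens i u x : opF (tens_uq V A) i (tens u x) =
  tens (opF V i u) (opKtV A i x) + tens u (opF A i x).
Proof.
transitivity (tens_op (opF V i) (opKtV A i) (tens u x) + tens_op id (opF A i) (tens u x)) => //.
rewrite !tens_op_tens //; [exact: uq_linF HA i|exact: uq_linF HV i|exact: opKtV_lin HA i].
Qed.

Lemma Phi_maximal lam m b : maximal q n A (part lam) b -> (0 < m <= n)%N ->
  (forall k, (0 < k < m)%N -> part lam m < part lam k) ->
  maximal q n (tens_uq V A) (fun i => part lam i + (i == m)%:Z) (Phi q n A lam m b).
Proof.
move=> maxb hm hlam; have [wb eb] := maxb.
have HT := tens_uqP q_neq0 HV HA.
have lT (u : {ffun 'I_n -> F^o}) := @tens_linr F _ M u.
split=> i hi.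
  rewrite /Phi (lin_sum _ _ _ (uq_linK HT i)) scaler_sumr; apply: eq_bigr => j _.
  have hj := ltn_ord j.
  rewrite (lin_Z (uq_linK HT i)) opK_tens vec_K.
  rewrite (Psi_weight _ wb) //; last lia.
  rewrite (lin_Z (lT _)) (lin_Z (tens_linl _)) !scalerA; congr (_ *: _).
  rewrite -mulrA -expfzDr // mulrC (_ : (m - j - 1 + j.+1 = m)%N); last lia.
  rewrite (_ : ((m - j - 1).+1 = m - j)%N); last lia.
  by rewrite (eq_sym i (m - j)%N); congr (q ^ _ * _); ring.
rewrite /Phi (lin_sum _ _ _ (uq_linE HT i)).
case: m hm hlam => [//|m] hm hlam.
(* The row is now [m + 1]. On term [j], [E_i (x) 1] gives [T j] and [Kt_i (x) E_i] gives
   [- T (j - 1)], because [Kt_i] acts on [v_i] by [q]. For [j = m] the first part is 0, as [E_i]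
   kills [v_1]. *)
pose T (j : nat) := (m - j == i)%N%:R *: ((- q^-1) ^+ j *:
  tens (vb F n i) (Psi q (shift i (opF A)) (shift i (part lam)) j b)).
transitivity (\sum_(j < m.+1) (if (j < m)%N then T j else 0)
              + \sum_(j < m.+1) (if nat_of_ord j is j'.+1 then - T j' else 0)); last first.
  rewrite big_ord_recr big_ord_recl /= ltnn addr0 add0r -big_split /=.
  by apply: big1 => j _; rewrite ltn_ord subrr.
rewrite -big_split; apply: eq_bigr => j' _; rewrite [RHS]/=.
move: (nat_of_ord j') (ltn_ord j') => j hj {j'}.
rewrite (lin_Z (uq_linE HT i)) opE_tens vec_E // vec_Kt.
rewrite (Psi_E (mu := part lam)) //; [|lia|]; last first.
  by move=> t ht; rewrite (_ : (_ + j).+1 = m.+1); [apply: hlam|]; lia.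
rewrite scalerDr; congr (_ + _).
  rewrite /T; have [eq_ji|neq_ji] := eqVneq (m.+1 - j)%N i.+1.
    rewrite (_ : (j < m)%N); last lia.
    rewrite (_ : (m - j == i)%N); last lia.
    by rewrite scale1r eq_ji subSS subn0.
  rewrite (_ : (m - j == i)%N = false) ?scale0r ?if_same; last lia.
  by rewrite (lin_0 (tens_linl _)) scaler0.
case: j hj => [|j] hj; first by rewrite andbF (lin_0 (lT _)) scaler0.
rewrite andbT /T subSS -[(m - j - 1)%N.+1]addn1 subnK; last lia.
rewrite [i == _]eq_sym; have [->|neq_ji] := eqVneq (m - j)%N i; last first.
  by rewrite (lin_0 (lT _)) scaler0 scale0r oppr0.
rewrite scale1r (_ : (i == i.+1) = false); last lia.
rewrite (lin_Z (tens_linl _)) scalerA -scaleNr subr0 expr1z exprS; congr (_ *: _).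
by rewrite mulrAC mulNr mulVf // mulN1r.
Qed.

End PhiMaximal.

(** * Adjoints for the form and pairing with maximal vectors *)

Section Form.
Variables (F : fieldType) (q : F) (n : nat).
Hypotheses (q_neq0 : q != 0) (q_nroot : forall k, (0 < k)%N -> q ^+ k != 1).
Local Notation A r := (tpow_uq q n r).

Let tpowP r : is_uq_module q n (A r) := tpow_uqP n r q_neq0 (q_nroot (isT : 0 < 2)%N).
Let vecP : is_uq_module q n (vec_uq q n) := vec_uqP n q_neq0 (q_nroot (isT : 0 < 2)%N).

Lemma tform_0r r (x : tpow F n r) : tform x 0 = 0.
Proof. by rewrite tform_sym tform_0l. Qed.

Lemma tform_Zr r (x y : tpow F n r) a : tform x (a *: y) = a * tform x y.
Proof. by rewrite tform_sym tform_Zl tform_sym. Qed.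

Lemma tform_suml r (y : tpow F n r) (J : Type) (s : seq J) (P : pred J) g :
  tform (\sum_(j <- s | P j) g j) y = \sum_(j <- s | P j) tform (g j) y.
Proof.
apply: (big_morph (fun x => tform x y)) => [x x'|]; last exact: tform_0l.
by rewrite -[x]scale1r tform_linl mul1r scale1r.
Qed.

Lemma tform_sumr r (x : tpow F n r) (J : Type) (s : seq J) (P : pred J) g :
  tform x (\sum_(j <- s | P j) g j) = \sum_(j <- s | P j) tform x (g j).
Proof.
by rewrite tform_sym tform_suml; apply: eq_bigr => j _; rewrite tform_sym.
Qed.

(** The first hypothesis makes [f'] the transpose of [f] on the basis. *)
Lemma tform_tens_op r (f f' : {ffun 'I_n -> F^o} -> {ffun 'I_n -> F^o})
    (g g' : tpow F n r -> tpow F n r) (x y : {ffun 'I_n -> tpow F n r}) :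
  (forall k l, f (basis_vec F k) l = f' (basis_vec F l) k) ->
  (forall u v, tform (g u) v = tform u (g' v)) ->
  tform (tens_op f g x : tpow F n r.+1) y = tform (x : tpow F n r.+1) (tens_op f' g' y).
Proof.
move=> ff gg /=.
transitivity (\sum_l \sum_k f (basis_vec F k) l * tform (g (x k)) (y l)).
  apply: eq_bigr => l _; rewrite sum_ffunE tform_suml; apply: eq_bigr => k _.
  by rewrite ffunE tform_Zl.
rewrite exchange_big; apply: eq_bigr => k _; rewrite sum_ffunE tform_sumr.
by apply: eq_bigr => l _; rewrite ffunE tform_Zr ff gg.
Qed.

Lemma tform_K r i (x y : tpow F n r) :
  tform (opK (A r) i x) y = tform x (opK (A r) i y).
Proof.
elim: r x y => [//|r IHr] x y.
apply: tform_tens_op => // k l; rewrite -!vb_ord !vec_K !ffunE.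
by rewrite !eqSS [in LHS](eq_sym (l : nat)); case: (k =P l :> nat) => [->|_] //; rewrite !scaler0.
Qed.

(* On V itself, q^-1 F_i Kt_i = F_i is the transpose of E_i; the coproduct sends
   q^-1 F_i Kt_i to q^-1 F_i Kt_i (x) 1 + Kt_i (x) q^-1 F_i Kt_i. *)
Lemma tform_E r i (x y : tpow F n r) : (0 < i < n)%N ->
  tform (opE (A r) i x) y = q^-1 * tform x (opF (A r) i (opKt (A r) i y)).
Proof.
move=> hi; elim: r x y => [|r IHr] x y; first by rewrite /= mul0r !mulr0.
have lKt := opKt_lin (tpowP r); have lKtV := opKt_lin vecP.
have lF := uq_linF (tpowP r); have lFV := uq_linF vecP.
have lK := uq_linK (tpowP r); have lKtVr := opKtV_lin (tpowP r).
have FKt u : opF (vec_uq q n) i (opKt (vec_uq q n) i u) = q *: opF (vec_uq q n) i u.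
  move: u; apply: eq_on_vb => [||k].
  - exact: lin_comp (lFV i) (lKtV i).
  - exact: lin_scale (lFV i).
  rewrite (vec_Kt _ q_neq0 q_nroot) (lin_Z (lFV i)) vec_F //.
  case: eqP => [->|_]; last by rewrite !scaler0.
  by rewrite (_ : (i == i.+1) = false) ?subr0 ?expr1z //; lia.
have -> : opKt (A r.+1) i y = tens_op (opKt (vec_uq q n) i) (opKt (A r) i) y.
  by rewrite /opKt /= tens_op_comp //; exact: lin_ext_lin.
have -> : opF (A r.+1) i (tens_op (opKt (vec_uq q n) i) (opKt (A r) i) y) =
    q *: (tens_op (opF (vec_uq q n) i) id y
          + tens_op (opKt (vec_uq q n) i) (fun u => q^-1 *: opF (A r) i (opKt (A r) i u)) y).
  rewrite [LHS](_ : _ = tens_op (opF (vec_uq q n) i) (opKtV (A r) i)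
      (tens_op (opKt (vec_uq q n) i) (opKt (A r) i) y)
    + tens_op id (opF (A r) i) (tens_op (opKt (vec_uq q n) i) (opKt (A r) i) y)) //.
  rewrite !tens_op_comp //.
  rewrite scalerDr; congr (_ + _).
    apply: tens_op_eqZl; first exact: FKt.
    (* On the right factor, [Kt_i^-1] from the coproduct of [F_i] cancels [Kt_i]. *)
    move=> u /=; rewrite /opKtV /opKt (uq_KK (tpowP r)); [|lia|lia].
    by rewrite (uq_KVK (tpowP r)) ?(uq_KKV (tpowP r)) //; lia.
  by apply: tens_op_eqZr => // u /=; rewrite scalerA mulfV // scale1r.
rewrite tform_Zr mulrA mulVf // mul1r.
rewrite [LHS](_ : _ = tform (tens_op (opE (vec_uq q n) i) id x
   + tens_op (opKt (vec_uq q n) i) (opE (A r) i) x : tpow F n r.+1) y) //.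
have tD (a b c : tpow F n r.+1) : tform (a + b) c = tform a c + tform b c.
  by rewrite -[a]scale1r tform_linl mul1r scale1r.
rewrite tD [RHS]tform_sym tD; congr (_ + _).
  rewrite [RHS]tform_sym; apply: tform_tens_op => // k l.
  rewrite -!vb_ord vec_E // vec_F //.
  by case: ifP => ki; case: ifP => li; rewrite !ffunE ?ki ?li.
rewrite [RHS]tform_sym; apply: tform_tens_op => [k l|u v]; last first.
  by rewrite IHr tform_Zr.
rewrite -!vb_ord !(vec_Kt _ q_neq0 q_nroot) !ffunE.
by rewrite !eqSS [in LHS](eq_sym (l : nat)); case: (k =P l :> nat) => [->|_] //; rewrite !scaler0.
Qed.

Lemma tform_weight r mu nu (x y : tpow F n r) i : (0 < i <= n)%N ->
  has_weight q n (A r) mu x -> has_weight q n (A r) nu y -> mu i != nu i ->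
  tform x y = 0.
Proof.
move=> hi wx wy /eqP neq_i; have := tform_K i x y.
rewrite wx // wy // tform_Zl tform_Zr => /eqP; rewrite -subr_eq0 -mulrBl mulf_eq0.
case/orP => [|/eqP //]; rewrite subr_eq0 => /eqP /(expz_inj q_neq0 q_nroot) //.
Qed.

(** The adjunction is applied to [opKtV i y], whose image under [opKt i] is [y]. *)
Lemma tform_max_F r (w y : tpow F n r) i : (0 < i < n)%N ->
  opE (A r) i w = 0 -> tform w (opF (A r) i y) = 0.
Proof.
move=> hi ew; have := tform_E w (opKtV (A r) i y) hi.
rewrite ew tform_0l /opKt /opKtV.
rewrite (uq_KVKV (tpowP r)); [|lia|lia]; rewrite (uq_KVK (tpowP r)); last lia.
rewrite (uq_KKV (tpowP r)); last lia.
by move/esym/eqP; rewrite mulf_eq0 invr_eq0 (negPf q_neq0) => /eqP.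
Qed.

(** This is [d_k] for [lam] shifted by [m - k - 1]: the axial distance from the end of row [m - k]
    to the box to be added in row [m]. *)
Definition row_dist (lam : seq nat) (m k : nat) : int :=
  part lam (m - k)%N - part lam m + k%:Z - 1.

(** The factor by which [Phi_m] multiplies the value of the form on a maximal vector and itself. *)
Definition Phi_norm (lam : seq nat) (m : nat) : F :=
  q^-1 ^+ m.-1 * \prod_(k < m.-1)
    (qint q (row_dist lam m k.+1 + 1) / qint q (row_dist lam m k.+1)).

Lemma row_dist_gt0 lam m k :
  (forall k, (0 < k < m)%N -> part lam m < part lam k) -> (0 < k < m)%N ->
  0 < row_dist lam m k.
Proof. by move=> hlam hk; have := hlam (m - k)%N; rewrite /row_dist; lia. Qed.

Lemma Phi_norm_neq0 lam m :
  (forall k, (0 < k < m)%N -> part lam m < part lam k) -> Phi_norm lam m != 0.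
Proof.
move=> hlam; rewrite mulf_neq0 ?expf_neq0 ?invr_eq0 //.
apply/prodf_neq0 => k _; have hk := ltn_ord k.
have D0 : 0 < row_dist lam m k.+1 by apply: row_dist_gt0 => //; lia.
by rewrite mulf_neq0 ?invr_eq0 // qint_neq0 //; lia.
Qed.

(* Pairing with a maximal vector w kills F_i (V (x) M), so that in
   <w, v_(m-j) (x) Psi_j b> only the monomial F_(m-j) ... F_(m-1) of Psi_j
   contributes, by a multiple of <w, v_m (x) b>; these multiples telescope. *)
Lemma tform_Phi r (w : tpow F n r.+1) lam m (b : tpow F n r) :
  (forall i, (0 < i < n)%N -> opE (A r.+1) i w = 0) ->
  has_weight q n (A r) (part lam) b -> (0 < m <= n)%N ->
  (forall k, (0 < k < m)%N -> part lam m < part lam k) ->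
  tform w (Phi q n (A r) lam m b : tpow F n r.+1) =
  Phi_norm lam m * tform w (tens (vb F n m) b : tpow F n r.+1).
Proof.
move=> ew wb hm hlam.
pose L i (y : tpow F n r) : F^o := tform w (tens (vb F n i) y : tpow F n r.+1).
have lL i : linear (L i).
  by move=> a x y; rewrite /L tens_linr tform_linr.
have Hl := uq_ladder q_neq0 (tpowP r).
(* As [w] is orthogonal to [F_k (v_i (x) y)], the coproduct moves [F_k] from [y] to [v_i], at the
   cost of a sign and of [Kt_k^-1] on [y]. *)
have LF i k y : (0 < i <= n.-1)%N -> (0 < k <= n.-1)%N ->
    L i (opF (A r) k y) =
    - tform w (tens (opF (vec_uq q n) k (vb F n i)) (opKtV (A r) k y) : tpow F n r.+1).
  move=> hi hk; have hk' : (0 < k < n)%N by lia.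
  have := tform_max_F (tens (vb F n i) y : tpow F n r.+1) hk' (ew _ hk').
  rewrite (opF_tens q_neq0 q_nroot (tpowP r)) -[X in tform w (X + _)]scale1r tform_linr mul1r.
  by move/eqP; rewrite addrC addr_eq0 => /eqP.
case: m hm hlam => [//|m] hm hlam.
rewrite /Phi tform_sumr big_ord_recl.
have E j : (j < m)%N -> tform w ((- q^-1) ^+ j.+1 *: tens (vb F n (m.+1 - j.+1))
    (Psi q (shift (m.+1 - j.+1 - 1) (opF (A r))) (shift (m.+1 - j.+1 - 1) (part lam)) j.+1 b)
      : tpow F n r.+1) =
  q^-1 ^+ j.+1 * (q ^ (- row_dist lam m.+1 j.+1) / qint q (row_dist lam m.+1 j.+1) *
       \prod_(k < j) (qint q (row_dist lam m.+1 k.+1 + 1) / qint q (row_dist lam m.+1 k.+1)))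
    * L m.+1 b.
  move=> hj; set s := (m.+1 - j.+1 - 1)%N.
  have := @Psi_form F q (tpow F n r) (n.-1 - s) _ _ _ (shift s (part lam)) (row_dist lam m.+1)
    (shift s L) j b q_neq0 q_nroot (ladder_shift s Hl).
  rewrite tform_Zr -[tform w _]/(L (m.+1 - j.+1)%N _).
  rewrite (_ : L (m.+1 - j.+1)%N = shift s L 1%N); last by rewrite /shift /s; congr L; lia.
  move=> ->; try lia.
  - rewrite (_ : shift s L j.+2 = L m.+1); last by rewrite /shift /s; congr L; lia.
    have mulA4 (a e p l : F) : a * (e * p * l) = a * e * p * l by ring.
    (* The sign from [Psi_form] cancels that of [(- q^-1) ^+ j.+1]. *)
    by rewrite [LHS]mulA4 -exprMn mulrN1 opprK.
  - by move=> i; exact: lL.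
  - move=> i k y hi hk /negPf ik; rewrite /shift LF; [|lia|lia].
    rewrite vec_F ?eqn_add2r ?ik; last lia.
    by rewrite (lin_0 (tens_linl _)) tform_0r oppr0.
  - move=> i a y hi [_ Vy]; rewrite /shift LF; [|lia|lia].
    by rewrite vec_F ?eqxx ?Vy ?(lin_Z (tens_linr _)) ?tform_Zr //; lia.
  - move=> k hk; rewrite /shift addSn; apply: (has_weight_Kt q_neq0 (tpowP r)) => //; lia.
  - move=> k hk; rewrite /row_dist /shift; congr (part _ _ - part _ _ + _ - _); lia.
rewrite expr0 scale1r subn0 [X in _ + X](eq_bigr _ (fun (j : 'I_m) _ => E j (ltn_ord j))).
rewrite -mulr_suml -[X in X + _]mul1r -mulrDl.
rewrite (qint_telescope q_neq0 q_nroot) // => k hk.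
by rewrite qint_neq0 //; have := @row_dist_gt0 lam m.+1 k hlam; lia.
Qed.

End Form.

(** * Partitions and addable boxes *)

Lemma part_incr_nth lam k i : (0 < i)%N ->
  part (incr_nth lam k) i = part lam i + (i == k.+1)%:Z.
Proof.
by case: i => // i _; rewrite /part nth_incr_nth eqSS [k == i]eq_sym PoszD addrC.
Qed.

Lemma part_leq lam i j : is_partition lam -> (0 < i <= j)%N -> part lam j <= part lam i.
Proof.
case/andP=> sorted_lam _ hij; rewrite /part lez_nat.
have [lt_j|le_j] := ltnP j.-1 (size lam); last by rewrite nth_default.
have geq_trans : transitive geq by move=> y x z /= hyx hzy; exact: leq_trans hzy hyx.
by apply: (sorted_leq_nth geq_trans leqnn) => //; rewrite ?inE; lia.
Qed.

(** Parts are nonzero, so the parts determine the length: a longer list would contain a 0. *)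
Lemma eq_partition n lam mu : is_partition lam -> is_partition mu ->
  (size lam <= n)%N -> (size mu <= n)%N ->
  (forall i, (0 < i <= n)%N -> part lam i = part mu i) -> lam = mu.
Proof.
have size_le (s t : seq nat) : is_partition s -> (size s <= n)%N ->
    (forall i, (0 < i <= n)%N -> part s i = part t i) -> (size s <= size t)%N.
  move=> /andP[_ s0] sn st; rewrite leqNgt; apply: contra s0 => lt_ts.
  have := st (size t).+1; rewrite /part /= [nth _ t _]nth_default // => st0.
  have /eqP := st0 ltac:(lia); rewrite eqz_nat => /eqP <-.
  exact: mem_nth.
move=> plam pmu slam smu eq_part.
have eq_size : size lam = size mu.
  apply/eqP; rewrite eqn_leq !size_le // => i hi.
  by rewrite eq_part.
apply: (eq_from_nth (x0 := 0%N)) => // i hi.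
have /eqP := eq_part i.+1 ltac:(lia).
by rewrite /part eqz_nat => /eqP.
Qed.

Lemma box_rowP n lam mu : bratteli_edge n lam mu ->
  (0 < box_row n lam mu <= n)%N /\ mu = incr_nth lam (box_row n lam mu).-1.
Proof.
case/existsP=> k muk; rewrite /box_row /=.
have hs : has (fun k => mu == incr_nth lam k) (iota 0 n).
  by apply/hasP; exists (k : nat); rewrite // mem_iota /=.
have := hs; rewrite has_find size_iota => hk; split=> //.
by have := nth_find 0%N hs; rewrite nth_iota // => /eqP.
Qed.

(** The enlarged shape is weakly decreasing and only row [k + 1] has grown. This is the condition
    under which [Phi] is applied. *)
Lemma addable_row lam k : is_partition lam -> is_partition (incr_nth lam k) ->
  forall i, (0 < i < k.+1)%N -> part lam k.+1 < part lam i.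
Proof.
move=> plam pmu i hi; have := @part_leq _ i k.+1 pmu.
rewrite !part_incr_nth //; last lia.
rewrite eqxx (_ : (i == k.+1) = false); lia.
Qed.

(** * Walks and the induction on their length *)

Section Walks.
Variables (F : fieldType) (q : F) (n : nat).
Hypotheses (q_neq0 : q != 0) (q_nroot : forall k, (0 < k)%N -> q ^+ k != 1).
Local Notation A r := (tpow_uq q n r).

(** With a function in place of a tuple, truncating a walk changes only [r]. *)
Definition walk_fun (r : nat) (p : nat -> seq nat) : Prop :=
  (forall j, (j <= r)%N -> bratteli_vertex n j (p j)) /\
  (forall j, (j < r)%N -> bratteli_edge n (p j) (p j.+1)).

Lemma walk_funS r p : walk_fun r.+1 p -> walk_fun r p.
Proof. by case=> hv he; split=> j hj; [apply: hv|apply: he]; lia. Qed.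

Lemma walk_fun_partition r p : walk_fun r p ->
  is_partition (p r) /\ (size (p r) <= n)%N.
Proof. by case=> /(_ r (leqnn r))/and3P[]. Qed.

Lemma walk_fun_step r p (m := box_row n (p r) (p r.+1)) : walk_fun r.+1 p ->
  [/\ (0 < m <= n)%N, p r.+1 = incr_nth (p r) m.-1 &
      forall i, (0 < i < m)%N -> part (p r) m < part (p r) i].
Proof.
move=> wp; have [_ he] := wp; have [hm pm] := box_rowP (he r (leqnn _)).
have [part_r _] := walk_fun_partition (walk_funS wp).
have [part_rS _] := walk_fun_partition wp.
split=> // i hi; have := @addable_row (p r) m.-1 part_r.
by rewrite -pm prednK //; apply.
Qed.

Lemma cvec_maximal r p : walk_fun r p ->
  maximal q n (A r) (part (p r)) (cvec_of q n p r).
Proof.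
elim: r => [|r IHr] wp.
  split=> // i hi /=; have [/(_ 0%N (leqnn _))/and3P[_ _ p0] _] := wp.
  rewrite (_ : part _ _ = 0) ?expr0z ?scale1r // /part.
  have: all (fun k => k == 0%N) (p 0%N).
    by elim: (p 0%N) p0 => //= k s IHs; rewrite addn_eq0 => /andP[-> /IHs].
  by move/all_nthP => /(_ 0%N i.-1); case: ltnP => [_ /(_ isT)/eqP->|/(nth_default 0%N)->].
have [hm pm hlam] := walk_fun_step wp.
have [wC eC] := Phi_maximal q_neq0 q_nroot (tpow_uqP n r q_neq0 (q_nroot (isT : 0 < 2)%N))
  (IHr (walk_funS wp)) hm hlam.
split=> // i hi; rewrite [LHS]wC // [in RHS]pm part_incr_nth; last by case/andP: hi.
by rewrite prednK.
Qed.

(** Triangularity: the terms with [j > 0] lie over [v_i] with [i < m], so only [v_m (x) b] can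
    contribute. *)
Lemma Phi_coord r lam m (b : tpow F n r) (k : 'I_n) : (m <= k.+1)%N ->
  Phi q n (A r) lam m b k = if m == k.+1 then b else 0.
Proof.
move=> hmk; rewrite /Phi sum_ffunE; case: m hmk => [|m] hmk.
  by rewrite big_ord0.
rewrite big_ord_recl big1 => [|j _].
  rewrite expr0 scale1r subn0 !ffunE eq_sym addr0.
  by case: eqP => _; rewrite ?scale1r ?scale0r.
by rewrite !ffunE lift0 (_ : (k.+1 == _)%N = false) ?scale0r ?scaler0 //; lia.
Qed.

Lemma tform_Phi_vb r lam m m' (b b' : tpow F n r) : (m <= m')%N -> (0 < m' <= n)%N ->
  tform (Phi q n (A r) lam m b : tpow F n r.+1) (tens (vb F n m') b' : tpow F n r.+1) =
  if m == m' then tform b b' else 0.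
Proof.
case: m' => [//|k] le_m lt_kn.
rewrite -[k]/(nat_of_ord (Ordinal (lt_kn : (k < n)%N))) vb_ord tform_tens Phi_coord //.
by case: eqP => // _; rewrite tform_0l.
Qed.

(** [tform_Phi] expands the vector with the larger row [m']; only then does triangularity evaluate
    the other one at [v_m']. *)
Lemma tform_cvecS r p p' (m := box_row n (p r) (p r.+1))
    (m' := box_row n (p' r) (p' r.+1)) :
  walk_fun r.+1 p -> walk_fun r.+1 p' -> (m <= m')%N ->
  tform (cvec_of q n p r.+1) (cvec_of q n p' r.+1) =
  if m == m' then Phi_norm q (p' r) m' * tform (cvec_of q n p r) (cvec_of q n p' r)
  else 0.
Proof.
move=> wp wp' le_m; have [hm _ _] := walk_fun_step wp.
have [hm' _ hlam'] := walk_fun_step wp'.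
have [_ ep] := cvec_maximal wp; have [wp'r _] := cvec_maximal (walk_funS wp').
have -> : tform (cvec_of q n p r.+1) (cvec_of q n p' r.+1) =
    tform (cvec_of q n p r.+1) (Phi q n (A r) (p' r) m' (cvec_of q n p' r) : tpow F n r.+1).
  by [].
rewrite (tform_Phi q_neq0 q_nroot ep wp'r hm' hlam').
by rewrite tform_Phi_vb //; case: eqP => //; rewrite mulr0.
Qed.

Lemma tform_cvec_neq0 r p : walk_fun r p ->
  tform (cvec_of q n p r) (cvec_of q n p r) != 0.
Proof.
elim: r => [|r IHr] wp; first by rewrite /= mulr1 oner_eq0.
rewrite tform_cvecS // eqxx mulf_neq0 ?IHr //; last exact: walk_funS.
by apply: (Phi_norm_neq0 q_neq0 q_nroot); case: (walk_fun_step wp).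
Qed.

(** Different endpoints give different weights. With equal endpoints the walks differ earlier, and
    the pairing is either 0 or a multiple of that of the truncations. *)
Lemma tform_cvec_neq r p p' j : walk_fun r p -> walk_fun r p' ->
  (j <= r)%N -> p j != p' j -> tform (cvec_of q n p r) (cvec_of q n p' r) = 0.
Proof.
elim: r j => [|r IHr] j wp wp' hj pj.
  have max_nil p0 : walk_fun 0 p0 -> p0 0%N = [::].
    case=> /(_ 0%N isT)/and3P[/andP[_]].
    by case: (p0 0%N) => //= k s; rewrite inE addn_eq0 negb_or eq_sym => /andP[/negPf->].
  by move: pj hj; rewrite leqn0 => pj /eqP j0; move: pj; rewrite j0 !max_nil // eqxx.
have [eq_end|neq_end] := eqVneq (p r.+1) (p' r.+1); last first.
  have [part_p size_p] := walk_fun_partition wp.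
  have [part_p' size_p'] := walk_fun_partition wp'.
  have [eq_part|] := boolP [forall i : 'I_n, part (p r.+1) i.+1 == part (p' r.+1) i.+1].
    case/eqP: neq_end; apply: (eq_partition part_p part_p' size_p size_p') => -[|i] hi //.
    by have /eqP := forallP eq_part (Ordinal (hi : (i < n)%N)).
  case/forallPn => i neq_i.
  have [wC _] := cvec_maximal wp; have [wC' _] := cvec_maximal wp'.
  exact: (tform_weight (i := i.+1) q_neq0 q_nroot (ltn_ord i) wC wC').
have hjr : (j <= r)%N.
  by move: hj; rewrite leq_eqVlt => /orP[/eqP ej|//]; rewrite ej eq_end eqxx in pj.
have IH := IHr j (walk_funS wp) (walk_funS wp') hjr pj.
(* Symmetry of the form reduces to the order of rows required by [tform_cvecS]. *)
case: (leqP (box_row n (p r) (p r.+1)) (box_row n (p' r) (p' r.+1))) => [le_m|/ltnW le_m].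
  by rewrite tform_cvecS // IH mulr0 if_same.
by rewrite tform_sym tform_cvecS // tform_sym IH mulr0 if_same.
Qed.

End Walks.

Lemma walk_fun_nth n r (pi : walk n r) : walk_fun n r (fun j => nth [::] pi j).
Proof.
have /andP[/forallP hv /forallP he] := walkP pi; split=> j hj.
  exact: (hv (Ordinal (hj : (j < r.+1)%N))).
exact: (he (Ordinal hj)).
Qed.

Theorem theorem7p1 (F : fieldType) (q : F) (n r : nat)
  (q_neq0 : q != 0)
  (q_not_root_of_unity : forall k : nat, (0 < k)%N -> q ^+ k != 1)
  (n_ge1 : (1 <= n)%N)
  (pi pi' : walk n r) :
  (pi <> pi' -> tform (cvec q pi) (cvec q pi') = 0) /\
  tform (cvec q pi) (cvec q pi) <> 0.
Proof.
have [wpi wpi'] := (walk_fun_nth pi, walk_fun_nth pi'); split; last first.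
  by apply/eqP; exact: tform_cvec_neq0.
move=> neq_pi.
have [/forallP eq_pi|/forallPn[j neq_j]] :=
  boolP [forall j : 'I_r.+1, nth [::] pi j == nth [::] pi' j].
  case: neq_pi; apply: val_inj; apply: val_inj.
  apply: (eq_from_nth (x0 := [::])); first by rewrite !size_tuple.
  by move=> j; rewrite size_tuple => hj; apply/eqP; exact: (eq_pi (Ordinal hj)).
exact: (tform_cvec_neq q_neq0 q_not_root_of_unity wpi wpi' (ltn_ord j) neq_j).
Qed.
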